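(* Let $k$ be an algebraically closed field of characteristic $p>0$, let $q=p^e$ with $e\ge1$, and let $X\subset\mathbb P^3_k$ be a smooth extremal surface of degree $q+1$. Then $X$ contains exactly $\frac12(q^3+1)(q^2+1)q^4$ quadric configurations.
   Context: $k$ is an algebraically closed field of characteristic $p>0$ and $q=p^e$ with $e\ge1$. A Frobenius form is a homogeneous polynomial of degree $q+1$ of the form $\sum_i x_i^{q}L_i$ with each $L_i$ a linear form. An extremal surface of degree $q+1$ is a surface in $\mathbb P^3_k$ defined by a Frobenius form of degree $q+1$ in four variables. A quadric configuration on a surface of degree $d\ge3$ in $\mathbb P^3$ is a collection of $2d$ lines on the surface consisting of two sets of $d$ pairwise skew lines with the property that each line in either set meets every line of the other set. *)

(* Defs.v *)
From HB Require Import structures.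
From mathcomp Require Import all_boot all_order all_algebra.
From mathcomp Require Import finmap mpoly.

Set Implicit Arguments.
Unset Strict Implicit.
Unset Printing Implicit Defensive.

Import GRing.Theory.
Local Open Scope ring_scope.

(* As usual, the zero form counts as a linear form, so that some of the L i
   (but also F itself) may vanish. *)
Definition frobenius_form (k : fieldType) (n q : nat) (F : {mpoly k[n]}) : Prop :=
  F \is q.+1.-homog /\
  exists L : 'I_n -> {mpoly k[n]},
    (forall i, L i \is 1.-homog) /\ F = \sum_(i < n) 'X_i ^+ q * L i.

(* Smoothness of the projective scheme V(F) over an algebraically closed field:
   the gradient of F does not vanish at any k-point of V(F), a point of P^(n-1)
   being represented by its nonzero homogeneous coordinate vectors.  This rules
   out F = 0 for n > 0. *)
Definition smooth_hypersurface (k : fieldType) (n : nat) (F : {mpoly k[n]}) : Prop :=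
  forall v : 'rV[k]_n, v != 0 -> F.@[v 0] = 0 ->
    exists i : 'I_n, (F^`M(i)).@[v 0] != 0.

(* A line of P^3 is identified with the plane of k^4 lying over it; two lines
   have a common point iff these planes intersect nontrivially. *)
Definition is_line (k : fieldType) (l : {vspace 'rV[k]_4}) : Prop :=
  \dim l = 2%N.

Definition meet (k : fieldType) (l m : {vspace 'rV[k]_4}) : Prop :=
  (l :&: m)%VS != 0%VS.

Definition skew (k : fieldType) (l m : {vspace 'rV[k]_4}) : Prop :=
  ~ meet l m.

Definition line_on (k : fieldType) (F : {mpoly k[4]}) (l : {vspace 'rV[k]_4}) : Prop :=
  is_line l /\ forall v : 'rV[k]_4, v \in l -> F.@[v 0] = 0.

(* The configuration is the set C of lines alone: neither the splitting into A
   and B nor its order is part of the data.  As msize is one more than the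
   total degree, d is the degree of the surface; the notion is meant for
   d >= 3. *)
Definition quadric_configuration (k : fieldType) (F : {mpoly k[4]})
    (C : {fset {vspace 'rV[k]_4}}) : Prop :=
  let d := (msize F).-1 in
  (forall l, l \in C -> line_on F l) /\
  #|` C| = (2 * d)%N /\
  exists A B : {fset {vspace 'rV[k]_4}},
    C = (A `|` B)%fset /\
    #|` A| = d /\ #|` B| = d /\
    (forall l m, l \in A -> m \in A -> l <> m -> skew l m) /\
    (forall l m, l \in B -> m \in B -> l <> m -> skew l m) /\
    (forall l m, l \in A -> m \in B -> meet l m).

(* Main.v *)
(* Writing the equation as F(v) = v^(q) A v^T, with ^(q) the entrywise q-th
   power, smoothness means that A is invertible, and the line spanned by the rows
   of M lies on the surface iff M^(q) A M^T = 0.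

   By Lang's theorem for GL_2 and x |-> x^(q^2), any two skew lines of the surface
   are the coordinate lines of a frame in which the equation becomes
   sum_i (x_i^q y_i - y_i^q x_i).  There, the lines skew to {x = 0} are the graphs
   of the 2 x 2 Hermitian matrices over F_(q^2), and the lines meeting both
   coordinate lines are indexed by P^1(F_(q^2)).  This counts the lines of the
   surface, the pairs of skew lines and the triples of pairwise skew lines.  Any
   three pairwise skew lines have, in a suitable frame, the equations x = 0,
   y = 0 and x = y, and their transversals on the surface correspond to the q+1
   zeros of a nondegenerate form u^(q) B u^T on P^1; hence they lie in exactly one
   half of exactly one quadric configuration.  Counting triples of skew lines in
   two ways gives the result.  That skew lines exist at all follows from the
   Fermat form, obtained from Lang's theorem for GL_4 by Gram-Schmidt. *)

Require Import Defs.
From HB Require Import structures.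
From mathcomp Require Import all_boot all_order all_algebra.
From mathcomp Require Import finmap mpoly separable zify ring.

Set Implicit Arguments.
Unset Strict Implicit.
Unset Printing Implicit Defensive.

Import GRing.Theory.
Local Open Scope ring_scope.

(** * Cardinality of predicates *)

(** The predicates counted here live on infinite types such as [k] and its matrices and need not be
    decidable, so finiteness is part of the claim, witnessed by a duplicate-free enumeration. *)
Definition has_card (T : eqType) (P : T -> Prop) (n : nat) : Prop :=
  exists s : seq T, [/\ uniq s, forall x, x \in s <-> P x & size s = n].

Lemma has_card_ext (T : eqType) (P Q : T -> Prop) n :
  (forall x, P x <-> Q x) -> has_card P n -> has_card Q n.
Proof.
move=> PQ [s [us sP <-]]; exists s; split=> // x.
by rewrite sP PQ.
Qed.

Lemma has_card_image (T U : eqType) (f : T -> U) (P : T -> Prop) (Q : U -> Prop) n :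
    (forall x y, P x -> P y -> f x = f y -> x = y) ->
    (forall y, Q y <-> exists2 x, P x & y = f x) ->
  has_card P n -> has_card Q n.
Proof.
move=> fI QE [s [us sP <-]]; exists (map f s); split; last by rewrite size_map.
  by rewrite map_inj_in_uniq // => x y /sP Px /sP Py; apply: fI.
move=> y; rewrite QE; split.
  by case/mapP=> x /sP Px ->; exists x.
by case=> x /sP sx ->; apply: map_f.
Qed.

Lemma has_card_disjoint (T : eqType) (P Q : T -> Prop) n m :
    (forall x, P x -> ~ Q x) -> has_card P n -> has_card Q m ->
  has_card (fun x => P x \/ Q x) (n + m).
Proof.
move=> PQ [s [us sP <-]] [t [ut tQ <-]]; exists (s ++ t); split.
- rewrite cat_uniq us ut andbT; apply/hasPn => x /tQ Qx.
  by apply/negP => /sP /PQ.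
- move=> x; rewrite mem_cat; split.
    by case/orP=> [/sP|/tQ]; [left | right].
  by case=> [/sP|/tQ] ->; rewrite ?orbT.
- by rewrite size_cat.
Qed.

Lemma has_card_sigma (T U : eqType) (P : T -> Prop) (Q : T -> U -> Prop) n m :
    has_card P n -> (forall x, P x -> has_card (Q x) m) ->
  has_card (fun z : T * U => P z.1 /\ Q z.1 z.2) (n * m).
Proof.
move=> [s [us sP <-]] cQ; have {cQ} : forall x, x \in s -> has_card (Q x) m.
  by move=> x /sP; apply: cQ.
move=> cQ; suff: has_card (fun z : T * U => z.1 \in s /\ Q z.1 z.2) (size s * m).
  by apply: has_card_ext => z; rewrite sP.
elim: s us cQ {sP} => [|x s IHs] /=.
  by move=> _ _; exists [::]; split=> // z; split=> // -[].
case/andP=> xs us cQ; have cs := IHs us (fun y ys => cQ y (@mem_behead _ (x :: s) y ys)).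
have cx : has_card (fun z : T * U => z.1 = x /\ Q x z.2) m.
  apply: (has_card_image (f := pair x)) (cQ x (mem_head x s)).
    by move=> y y' _ _ [].
  by case=> a b /=; split=> [[-> Qb]|[y Qy [-> ->]]]; [exists b | ].
rewrite mulSn; apply: has_card_ext (has_card_disjoint _ cx cs).
  case=> a b /=; rewrite in_cons; split.
    by case=> [[-> Qb]|[-> Qab]]; rewrite ?eqxx ?orbT.
  by case=> /orP[/eqP-> Qxb|sa Qab]; [left | right].
by case=> a b /= [-> _] [sx _]; rewrite sx in xs.
Qed.

Lemma has_card_rem (T : eqType) (P : T -> Prop) (x : T) n :
  P x -> has_card P n -> has_card (fun y => P y /\ y <> x) n.-1.
Proof.
move=> Px [s [us sP <-]]; exists (rem x s); split.
- exact: rem_uniq.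
- move=> y; rewrite (mem_rem_uniq _ us) inE; split.
    by case/andP=> /eqP yx /sP Py.
  by case=> /sP sy /eqP yx; apply/andP.
- by rewrite size_rem //; apply/sP.
Qed.

Lemma has_card_option (T : eqType) (P : option T -> Prop) n :
    has_card (fun x => P (Some x)) n -> P None -> has_card P n.+1.
Proof.
move=> [s [us sP <-]] PN; exists (None :: map Some s); split.
- rewrite /= map_inj_uniq ?us ?andbT; last by move=> ? ? [].
  by apply/mapP => -[].
- case=> [x|]; rewrite in_cons /=; last by split.
  rewrite mem_map; last by move=> ? ? [].
  exact: sP.
- by rewrite /= size_map.
Qed.

Lemma has_card_option0 (T : eqType) (P : option T -> Prop) n :
    has_card (fun x => P (Some x)) n -> ~ P None -> has_card P n.
Proof.
move=> [s [us sP <-]] PN; exists (map Some s); split.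
- by rewrite map_inj_uniq // => ? ? [].
- case=> [x|] /=; last by split=> // /mapP[].
  rewrite mem_map; last by move=> ? ? [].
  exact: sP.
- by rewrite /= size_map.
Qed.

(** Over an algebraically closed field the polynomial splits, and separability makes the list of its
    roots duplicate-free. *)
Lemma has_card_roots (k : closedFieldType) (p : {poly k}) :
  separable_poly p -> has_card (fun x => root p x) (size p).-1.
Proof.
move=> sp; have [r pE] := closed_field_poly_normal p.
have p0 : lead_coef p != 0.
  by rewrite lead_coef_eq0; exact: separable_poly_neq0.
exists r; split.
- by rewrite -separable_prod_XsubC -(eqp_separable (eqp_scale _ p0)) -pE.
- by move=> x; rewrite pE rootZ // root_prod_XsubC.
- by rewrite pE size_scale // size_prod_XsubC.
Qed.

(** Moves a count by enumeration to the finite type of elements of [L], on which grids are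
    counted. *)
Lemma card_sub_has_card (T : choiceType) (L : {fset T}) (P : T -> Prop)
    (b : pred L) n :
    (forall x, P x -> x \in L) -> (forall z : L, b z <-> P (val z)) ->
  has_card P n -> #|[set z | b z]| = n.
Proof.
move=> PL bP [s [us sP <-]].
have sL x : x \in s -> x \in L by move/sP/PL.
have valK : map val (pmap (insub : T -> option L) s) = s.
  rewrite pmap_filter; last by move=> x; apply: insubK.
  by apply/all_filterP/allP => x /sL xL /=; rewrite insubT.
rewrite -[in RHS]valK size_map -(card_uniqP _).
  apply: eq_card => z; rewrite inE -(mem_map val_inj) valK.
  by apply/idP/idP => [/bP/sP|/sP/bP].
by rewrite -(map_inj_uniq val_inj) valK.
Qed.

(** * Counting grids by triples of skew lines *)

Section GridCount.

Local Open Scope nat_scope.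

Variables (I : finType) (sk : rel I) (q : nat).

(* I stands for the lines of the surface and sk for skewness. *)
Definition grid (AB : {set I} * {set I}) : bool :=
  [&& #|AB.1| == q.+1, #|AB.2| == q.+1,
      [forall x in AB.1, forall y in AB.1, (x != y) ==> sk x y],
      [forall x in AB.2, forall y in AB.2, (x != y) ==> sk x y]
    & [forall x in AB.1, forall y in AB.2, ~~ sk x y]].

Lemma gridP (A B : {set I}) :
  reflect [/\ #|A| = q.+1, #|B| = q.+1,
              {in A &, forall x y, x != y -> sk x y},
              {in B &, forall x y, x != y -> sk x y}
            & {in A & B, forall x y, ~~ sk x y}]
          (grid (A, B)).
Proof.
apply: (iffP and5P) => /= -[].
  move=> /eqP cA /eqP cB /forall_inP hA /forall_inP hB /forall_inP hAB.
  split=> // x y Hx Hy.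
  - by move/forall_inP: (hA x Hx) => /(_ y Hy) /implyP.
  - by move/forall_inP: (hB x Hx) => /(_ y Hy) /implyP.
  - by move/forall_inP: (hAB x Hx) => /(_ y Hy).
move=> -> -> hA hB hAB; split=> //.
- by apply/forall_inP=> x Hx; apply/forall_inP=> y Hy; apply/implyP; apply: hA.
- by apply/forall_inP=> x Hx; apply/forall_inP=> y Hy; apply/implyP; apply: hB.
- by apply/forall_inP=> x Hx; apply/forall_inP=> y Hy; apply: hAB.
Qed.

(** In the intended model, the common transversals of three lines; for a triad they form one half of
    a grid, and [perp] recovers the other half. *)
Definition trans (x y z : I) : {set I} :=
  [set w | [&& ~~ sk x w, ~~ sk y w & ~~ sk z w]].

Definition perp (B : {set I}) : {set I} := [set a | [forall b in B, ~~ sk a b]].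

Hypotheses (q_gt1 : 1 < q) (sk_sym : ssrbool.symmetric sk) (sk_irr : irreflexive sk).
Hypothesis sk_ex : exists x y, sk x y.
Hypothesis card_sk1 : forall x y, sk x y -> #|[set z | sk x z]| = q ^ 4.
Hypothesis card_sk2 : forall x y, sk x y ->
  #|[set z | sk x z && sk y z]| = q * q.-1 * (q ^ 2 + 1).
Hypothesis card_trans2 : forall x y, sk x y ->
  #|[set z | ~~ sk x z && ~~ sk y z]| = q ^ 2 + 1.
Hypothesis trans2_sk : forall x y z z', sk x y ->
  ~~ sk x z -> ~~ sk y z -> ~~ sk x z' -> ~~ sk y z' -> z != z' -> sk z z'.
Hypothesis card_trans : forall x y z, sk x y -> sk x z -> sk y z ->
  #|trans x y z| = q.+1.
Hypothesis regulus : forall x y z a b b1 b2 b3, sk x y -> sk x z -> sk y z ->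
  b \in trans x y z -> b1 \in trans x y z -> b2 \in trans x y z ->
  b3 \in trans x y z -> b1 != b2 -> b2 != b3 -> b3 != b1 ->
  ~~ sk a b1 -> ~~ sk a b2 -> ~~ sk a b3 -> ~~ sk a b.

Let triad (t : I * I * I) : bool :=
  [&& sk t.1.1 t.1.2, sk t.1.1 t.2 & sk t.1.2 t.2].

Let opp (t : I * I * I) : {set I} := trans t.1.1 t.1.2 t.2.

(** If [x] meets both lines of a skew pair, it is one of their q^2+1 transversals, and any other
    transversal is skew to it. *)
Lemma sk_extend x : exists y, sk x y.
Proof.
have [a [b sab]] := sk_ex.
case xa: (sk x a); first by exists a.
case xb: (sk x b); first by exists b.
have xT : x \in [set z | ~~ sk a z && ~~ sk b z].
  by rewrite inE sk_sym xa sk_sym xb.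
have : 0 < #|[set z | ~~ sk a z && ~~ sk b z] :\ x|.
  by have := cardsD1 x [set z | ~~ sk a z && ~~ sk b z];
     rewrite card_trans2 // xT; nia.
case/card_gt0P=> y; rewrite !inE => /and3P[yx ay by_]; exists y.
by apply: (trans2_sk sab); rewrite // 1?sk_sym ?xa ?xb // eq_sym.
Qed.

(** Inclusion-exclusion on the lines skew to either member of a skew pair gives 2q^4 - q(q-1)(q^2+1)
    + (q^2+1). *)
Lemma card_all : #|I| = (q ^ 3 + 1) * q.+1.
Proof.
have [x [y sxy]] := sk_ex.
have c1 := card_sk1 sxy; have c2 := card_sk2 sxy; have c0 := card_trans2 sxy.
have c1' : #|[set z | sk y z]| = q ^ 4 by apply: (@card_sk1 y x); rewrite sk_sym.
have IE : [set z | sk x z && sk y z] = [set z | sk x z] :&: [set z | sk y z].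
  by apply/setP=> z; rewrite !inE.
have NE : [set z | ~~ sk x z && ~~ sk y z] =
    ~: ([set z | sk x z] :|: [set z | sk y z]).
  by apply/setP=> z; rewrite !inE negb_or.
rewrite IE in c2; rewrite NE in c0.
have := cardsC ([set z | sk x z] :|: [set z | sk y z]).
have := cardsUI [set z | sk x z] [set z | sk y z].
rewrite c0 c1 c1' c2 => UI <-.
case: (q) q_gt1 UI => // r _ /=; rewrite /= => UI.
(* Adding the size of the intersection to both sides avoids truncated subtraction. *)
apply: (@addIn (r.+1 * r * (r.+1 ^ 2 + 1))); rewrite addnAC UI.
by rewrite !(expnS _ _.+1) !expn1; ring.
Qed.

Lemma card_triad : #|[set t | triad t]| =
  (q ^ 3 + 1) * q.+1 * q ^ 4 * (q * q.-1 * (q ^ 2 + 1)).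
Proof.
have cx x : \sum_(y | sk x y) #|[set z | sk x z && sk y z]| =
    q ^ 4 * (q * q.-1 * (q ^ 2 + 1)).
  (* [card_sk1] speaks only of an [x] that has a skew partner. *)
  have [y sxy] := sk_extend x.
  rewrite -(card_sk1 sxy) -sum_nat_const.
  by apply: eq_big => [z|z sxz]; rewrite ?inE ?card_sk2.
rewrite -card_all -mulnA -sum_nat_const; rewrite (eq_bigr _ (fun x _ => esym (cx x))).
under [RHS]eq_bigr do under eq_bigr do rewrite -sum1_card.
rewrite pair_big_dep /= pair_big_dep /= -sum1_card.
by apply: eq_bigl => -[[x y] z]; rewrite !inE /triad.
Qed.

(** The transversals of a triad are pairwise skew, so three of them form a triad again. By
    [regulus], a line meeting these three meets all, hence [perp] of the transversals is itself a
    set of transversals of a triad and has q+1 elements. *)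
Lemma grid_of_triad t : triad t -> grid (perp (opp t), opp t).
Proof.
case: t => -[x y] z; rewrite /triad /opp /= => /and3P[sxy sxz syz].
have cB := card_trans sxy sxz syz; set B := trans x y z in cB *.
have skB : {in B &, forall b b', b != b' -> sk b b'}.
  move=> b b'; rewrite !inE => /and3P[xb yb _] /and3P[xb' yb' _].
  exact: (trans2_sk sxy).
have /card_gt2P[b1 [b2 [b3 [[B1 B2 B3] [n12 n23 n31]]]]] : 2 < #|B| by rewrite cB.
have s12 := skB _ _ B1 B2 n12; have s23 := skB _ _ B2 B3 n23.
have s13 : sk b1 b3 by rewrite skB // eq_sym.
have AE : perp B = trans b1 b2 b3.
  apply/setP=> a; rewrite !inE; apply/forall_inP/and3P.
    by move=> aB; rewrite !(sk_sym _ a); split; apply: aB.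
  rewrite !(sk_sym _ a) => -[a1 a2 a3] b bB.
  exact: (regulus sxy sxz syz bB B1 B2 B3).
have cA : #|perp B| = q.+1 by rewrite AE card_trans.
apply/gridP; split=> //.
- move=> a a'; rewrite AE !inE => /and3P[xb yb _] /and3P[xb' yb' _].
  exact: (trans2_sk s12).
- by move=> a b; rewrite inE => /forall_inP; apply.
Qed.

(** Each half of the grid is contained in the corresponding set built from the triad, and both have
    q+1 elements. *)
Lemma grid_triad A B x y z : grid (A, B) -> x \in A -> y \in A -> z \in A ->
  x != y -> x != z -> y != z ->
  triad (x, y, z) /\ (perp (opp (x, y, z)), opp (x, y, z)) = (A, B).
Proof.
case/gridP=> cA cB skA skB mAB xA yA zA xy xz yz.
have sxy := skA _ _ xA yA xy; have sxz := skA _ _ xA zA xz.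
have syz := skA _ _ yA zA yz.
have txyz : triad (x, y, z) by rewrite /triad /= sxy sxz.
split=> //; have /gridP[cA' cB' _ _ _] := grid_of_triad txyz.
have BE : B = opp (x, y, z).
  apply/eqP; rewrite eqEcard cB' cB leqnn andbT; apply/subsetP=> b bB.
  by rewrite inE /= !mAB.
congr (_, _); last by [].
apply/esym/eqP; rewrite eqEcard cA' cA leqnn andbT; apply/subsetP=> a aA.
by rewrite inE; apply/forall_inP=> b; rewrite -BE => bB; apply: mAB.
Qed.

(** By [grid_triad], the triads producing a given grid are exactly the ordered triples of distinct
    elements of its first half. *)
Lemma card_grid_triples A B : grid (A, B) ->
  #|[set t | triad t && ((perp (opp t), opp t) == (A, B))]| = q.+1 * (q * q.-1).
Proof.
move=> gAB; have /gridP[cA cB _ _ _] := gAB.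
have mem_perp x y z : triad (x, y, z) ->
    [/\ x \in perp (opp (x, y, z)), y \in perp (opp (x, y, z))
      & z \in perp (opp (x, y, z))].
  by move=> _; split; rewrite inE; apply/forall_inP=> b; rewrite inE => /and3P[].
have -> : [set t | triad t && ((perp (opp t), opp t) == (A, B))] =
    [set t | [&& t.1.1 \in A, t.1.2 \in A :\ t.1.1 & t.2 \in A :\ t.1.1 :\ t.1.2]].
  apply/setP=> -[[x y] z]; rewrite !inE /=; apply/andP/idP.
    case=> txyz /eqP E; have := mem_perp _ _ _ txyz; case: E => -> _ [-> -> ->].
    case/and3P: txyz => /= sxy sxz syz; rewrite !andbT.
    have ns a b : sk a b -> b != a by apply: contraTneq => ->; rewrite sk_irr.
    by rewrite !ns.
  case/and4P=> xA /andP[yx yA] zy /andP[zx zA].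
  rewrite eq_sym in yx; rewrite eq_sym in zx; rewrite eq_sym in zy.
  by have [-> ->] := grid_triad gAB xA yA zA yx zx zy.
have step (C : {set I}) x n : #|C| = n.+1 -> x \in C -> #|C :\ x| = n.
  by move=> cC xC; have := cardsD1 x C; rewrite cC xC add1n => -[].
rewrite -sum1_card -cA -sum_nat_const.
have q1 : q = q.-1.+1 by rewrite prednK // ltnW.
transitivity (\sum_(x in A) \sum_(y in A :\ x) \sum_(z in A :\ x :\ y) 1).
  rewrite pair_big_dep pair_big_dep /=; apply: eq_bigl => -[[x y] z].
  by rewrite !inE /= -!andbA.
apply: eq_bigr => x xA; have cAx := step _ _ _ cA xA.
rewrite -[in RHS]cAx -sum_nat_const; apply: eq_bigr => y yA.
by rewrite sum1_card; apply: step; rewrite // cAx.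
Qed.

(** Partition the triads according to the grid they produce: every fibre has (q+1)q(q-1)
    elements. *)
Lemma card_grid : #|[set AB | grid AB]| = (q ^ 3 + 1) * (q ^ 2 + 1) * q ^ 4.
Proof.
have : \sum_(AB | grid AB) #|[set t | triad t && ((perp (opp t), opp t) == AB)]| =
    #|[set t | triad t]|.
  rewrite -[RHS]sum1_card.
  rewrite [RHS](partition_big (fun t => (perp (opp t), opp t)) grid) /=.
    apply: eq_bigr => AB _; rewrite -sum1_card.
    by apply: eq_bigl => t; rewrite !inE.
  by move=> t; rewrite inE; apply: grid_of_triad.
rewrite (eq_bigr (fun=> q.+1 * (q * q.-1))); last first.
  by move=> -[A B]; apply: card_grid_triples.
rewrite sum_nat_const card_triad cardsE.
(* With q = r+2, the factor (q+1)q(q-1) becomes (r+3)(r+2)(r+1), visibly positive, and can be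
   cancelled. *)
set c := #|_|; case: (q) q_gt1 => [|[|r]] // _ /= E.
apply/eqP; rewrite -(eqn_pmul2r (isT : 0 < r.+3 * (r.+2 * r.+1))) E.
by apply/eqP; ring.
Qed.

Lemma gridC A B : grid (A, B) -> grid (B, A).
Proof.
case/gridP=> cA cB skA skB mAB; apply/gridP; split=> // x y Bx Ay.
by rewrite sk_sym mAB.
Qed.

Lemma grid_disjoint A B x : grid (A, B) -> x \in A -> x \notin B.
Proof.
case/gridP=> cA _ skA _ mAB xA; apply/negP=> xB.
have /card_gt0P[y] : 0 < #|A :\ x|.
  by have := cardsD1 x A; rewrite cA xA add1n => -[<-]; apply: ltnW.
rewrite !inE => /andP[yx yA]; have := mAB y x yA xB.
by rewrite skA.
Qed.

Lemma card_grid_union A B : grid (A, B) -> #|A :|: B| = 2 * q.+1.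
Proof.
move=> gAB; have [cA cB _ _ _] := gridP _ _ gAB.
rewrite cardsU cA cB (_ : A :&: B = set0) ?cards0 ?subn0 ?mul2n ?addnn //.
apply/setP=> x; rewrite !inE; apply/negP=> /andP[xA].
exact/negP/grid_disjoint/xA.
Qed.

(** An element of [A'] lying in [B] would meet [x], but distinct elements of [A'] are skew; so [A']
    lies in [A], and sizes agree. *)
Lemma grid_inj A B A' B' x : grid (A, B) -> grid (A', B') ->
  A' :|: B' = A :|: B -> x \in A -> x \in A' -> (A', B') = (A, B).
Proof.
move=> gAB gAB' U xA xA'.
have [cA cB skA skB mAB] := gridP _ _ gAB.
have [cA' cB' skA' skB' mAB'] := gridP _ _ gAB'.
have AA' : A' = A.
  apply/eqP; rewrite eqEcard cA cA' leqnn andbT; apply/subsetP=> y yA'.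
  have : y \in A :|: B by rewrite -U inE yA'.
  rewrite inE => /orP[//|yB]; have [->//|yx] := eqVneq y x.
  by have := mAB x y xA yB; rewrite skA' // eq_sym.
congr (_, _) => //; apply/eqP; rewrite eqEcard cB cB' leqnn andbT.
apply/subsetP=> y yB'; have : y \in A :|: B by rewrite -U inE yB' orbT.
rewrite inE => /orP[yA|//]; rewrite -AA' in yA.
by have := grid_disjoint gAB' yA; rewrite yB'.
Qed.

(** Grids are ordered pairs, and a union determines the grid up to order: fixing [x] in [A], the
    grid is settled by the half in which [x] lies. The map to unions is therefore exactly
    two-to-one. *)
Lemma card_grid_unions :
  2 * #|[set AB.1 :|: AB.2 | AB in [set AB | grid AB]]| =
  (q ^ 3 + 1) * (q ^ 2 + 1) * q ^ 4.
Proof.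
rewrite -card_grid -[RHS]sum1_card.
rewrite (partition_big_imset (fun AB => AB.1 :|: AB.2)) /= mulnC -sum_nat_const.
apply: eq_bigr => C /imsetP[[A B]]; rewrite inE => gAB -> /=.
rewrite sum1_card; have gBA := gridC gAB; have [cA _ _ _ _] := gridP _ _ gAB.
have /card_gt0P[x xA] : 0 < #|A| by rewrite cA.
have AB : (A, B) != (B, A).
  by apply/eqP=> -[AB _]; have := grid_disjoint gAB xA; rewrite -AB xA.
transitivity #|[set (A, B); (B, A)]|; first by rewrite cards2 AB.
apply: eq_card => -[A' B']; rewrite !inE; apply/orP/andP => /=.
  by case=> /eqP[-> ->]; rewrite ?inE ?gAB ?gBA ?eqxx //; rewrite setUC eqxx.
rewrite inE => -[gAB' /eqP U].
have : x \in A' :|: B' by rewrite U inE xA.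
rewrite inE => /orP[xA'|xB'].
  by left; rewrite (grid_inj gAB gAB' U xA xA').
right; have U' : B' :|: A' = A :|: B by rewrite setUC.
by case: (grid_inj gAB (gridC gAB') U' xA xB') => -> ->.
Qed.

End GridCount.

(** * Lang's theorem *)

Lemma complete_row (k : fieldType) n (x : 'rV[k]_(1 + n)) : x != 0 ->
  exists2 G : 'M[k]_(1 + n), G \in unitmx & usubmx G = x.
Proof.
move=> x0; pose U : 'M[k]_(1, 1 + n) := row_mx 1%:M 0.
pose f : 'M[k]_(1 + n) := col_mx x 0.
have UfE : U *m f = x by rewrite mul_row_col mul1mx mul0mx addr0.
have U0 : U != 0.
  apply/eqP=> /(congr1 lsubmx); rewrite row_mxKl linear0.
  by move/matrixP/(_ 0 0); rewrite !mxE; apply/eqP; apply: oner_neq0.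
have [|G Gu GE] := @complete_unitmx _ _ _ U f.
  by rewrite UfE !rank_rV x0 U0.
exists G => //; rewrite -UfE GE -[G in RHS]vsubmxK mul_row_col mul1mx.
by rewrite mul0mx addr0.
Qed.

Section Lang.

Variables (k : closedFieldType) (Q : nat) (psi : {rmorphism k -> k}).
Hypotheses (psiE : forall x, psi x = x ^+ Q) (Q_gt1 : (1 < Q)%N).

(* If v_(i+1) = T v_i for a Q-semilinear map T and v_m = sum_(i < m) a_i v_i, then
   sum_(i < m) c_i v_i is fixed by T iff c_i = (recur_poly a i.+1).[t] for all i,
   where t = c_(m-1). *)
Fixpoint recur_poly (a : nat -> k) (i : nat) : {poly k} :=
  if i is j.+1 then recur_poly a j ^+ Q + a j *: 'X^Q else 0.

(** This makes [recur_poly a i - 'X] equal to X times a polynomial with constant term -1, whose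
    roots are then nonzero. *)
Lemma recur_polyXn a i : exists w, recur_poly a i = 'X^Q * w.
Proof.
elim: i => [|i [w IHi]] /=; first by exists 0; rewrite mulr0.
exists (w * recur_poly a i ^+ Q.-1 + (a i)%:P).
rewrite -[in LHS](prednK (ltnW Q_gt1)) exprS {1}IHi prednK ?(ltnW Q_gt1) //.
by rewrite mulrDr mulrA [_ * (a i)%:P]mulrC mul_polyC.
Qed.

Lemma size_exp_gt (p : {poly k}) : (Q < size p)%N -> (Q.+1 < size (p ^+ Q)%R)%N.
Proof.
move=> sp; have := size_exp p Q; move: (size (p ^+ Q)) sp => u.
by move: (size p) => v; nia. Qed.

(** A nonzero [recur_poly a i] is divisible by X^Q, so its Q-th power has degree above Q and the
    added multiple of X^Q cannot cancel its leading term. *)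
Lemma size_recur_poly a i j : (j < i)%N -> a j != 0 ->
  (Q < size (recur_poly a i))%N.
Proof.
have sX i0 : (size (a i0 *: 'X^Q)%R <= Q.+1)%N.
  by rewrite (leq_trans (size_scale_leq _ _)) // size_polyXn.
elim: i => // i IHi; rewrite ltnS => ji aj0 /=.
have [s0|s0] := eqVneq (recur_poly a i) 0.
  have [ij|ij] := ltnP j i; first by have := IHi ij aj0; rewrite s0 size_poly0.
  have E : j = i by apply/eqP; rewrite eqn_leq ij ji.
  by rewrite s0 expr0n gtn_eqF ?(ltnW Q_gt1) // add0r size_scale -?E // size_polyXn.
have [w wE] := recur_polyXn a i.
have w0 : w != 0 by apply: contraNneq s0 => w0; rewrite wE w0 mulr0.
have si : (Q < size (recur_poly a i))%N.
  rewrite wE size_monicM ?monicXn // size_polyXn.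
  by move: w0; rewrite -size_poly_gt0; lia.
have s1 := size_exp_gt si.
by rewrite size_polyDl ?(leq_ltn_trans (sX i)) // ltnW // ltnW.
Qed.

Lemma recur_poly_fixed a m j : (j < m)%N -> a j != 0 ->
  exists2 t, t != 0 & (recur_poly a m).[t] = t.
Proof.
move=> jm aj0; have sm := size_recur_poly jm aj0.
have [w wE] := recur_polyXn a m.
(* A root of [r] is a fixed point: [recur_poly a m - 'X] is ['X * r]. The degree bound makes [r]
   nonconstant. *)
pose r := 'X^(Q.-1) * w - 1.
have sE : recur_poly a m = 'X * (r + 1).
  by rewrite subrK mulrA -exprS prednK // ltnW.
have : size r != 1%N.
  apply/negP=> /size_poly1P[c _ rE]; move: sm; rewrite sE rE ltnNge.
  rewrite (leq_trans (size_polyMleq _ _)) // size_polyX /= -polyC1 -polyCD.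
  by rewrite (leq_trans _ Q_gt1) // ltnS size_polyC leq_b1.
case/closed_rootP=> t rt; exists t.
  apply: contraTneq rt => ->; rewrite /root !hornerE expr0n.
  by rewrite gtn_eqF ?mul0r ?sub0r ?oppr_eq0 ?oner_eq0 //; lia.
by rewrite sE hornerM hornerX hornerD (eqP rt) add0r -polyC1 hornerC mulr1.
Qed.

Lemma fixed_vector n (N : 'M[k]_n.+1) : N \in unitmx ->
  exists2 x : 'rV_n.+1, x != 0 & map_mx psi x *m N = x.
Proof.
move=> Nu; pose T (x : 'rV[k]_n.+1) := map_mx psi x *m N.
have T0 x : (T x == 0) = (x == 0).
  rewrite /T -(map_mx_eq0 psi x); apply/eqP/eqP => [T0|->]; last by rewrite mul0mx.
  by rewrite -(mulmxK Nu (map_mx psi x)) T0 mul0mx.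
pose v i := iter i T (const_mx 1).
have v0 i : v i != 0.
  elim: i => [|i IHi]; last by rewrite /v iterS T0.
  by apply/eqP=> /rowP/(_ 0); rewrite !mxE; apply/eqP; apply: oner_neq0.
pose K m : 'M_(m, n.+1) := \matrix_(i < m) v i.
(* n+2 vectors in dimension n+1 are dependent; the least such [m] expresses [v m] through the
   independent vectors before it. *)
have exK : exists m, ~~ row_free (K m.+1).
  by exists n.+1; rewrite /row_free neq_ltn ltnS rank_leq_col.
case: (ex_minnP exK) => m nKm1 minm.
have Km : row_free (K m).
  case: m minm {nKm1} => [|m] minm; first by rewrite /row_free [K 0%N]flatmx0 mxrank0.
  by apply/negPn/negP => /minm; rewrite ltnn.
have KS : (K m <= K m.+1)%MS.
  apply/row_subP=> i; rewrite rowK.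
  by have := row_sub (widen_ord (leqnSn m) i) (K m.+1); rewrite rowK.
have vK : (v m <= K m)%MS.
  have rK : (\rank (K m.+1) <= \rank (K m))%N.
    move: nKm1 Km; rewrite /row_free => nKm1 /eqP->.
    by rewrite -ltnS ltn_neqAle nKm1 rank_leq_row.
  have := row_sub (@ord_max m) (K m.+1); rewrite rowK => /submx_trans; apply.
  by rewrite -(geq_leqif (mxrank_leqif_sup KS)).
have /submxP[D vE] := vK.
pose a i := if insub i is Some i' then D 0 i' else 0.
have aE (i : 'I_m) : a i = D 0 i by rewrite /a valK.
have vmE : v m = \sum_(i < m) a i *: v i.
  by rewrite vE mulmx_sum_row; apply: eq_bigr => i _; rewrite aE rowK.
have [j aj0] : exists j : 'I_m, a j != 0.
  apply/existsP; apply: contraNT (v0 m); rewrite negb_exists => /forallP a0.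
  by rewrite vmE big1 // => i _; have := a0 i; rewrite negbK => /eqP ->; rewrite scale0r.
have [t t0 tE] := recur_poly_fixed (ltn_ord j) aj0.
(* The index is shifted by one: [c i.+1] is the coefficient of [v i], so that [c 0 = 0] and
   [c m = t]. The last coefficient being nonzero makes [y] nonzero. *)
pose c i := (recur_poly a i).[t].
have c0 : c 0%N = 0 by rewrite /c horner0.
have cS i : c i.+1 = psi (c i) + psi t * a i.
  by rewrite /c /= !hornerE !psiE mulrC.
pose y := \sum_(i < m) c i.+1 *: v i.
exists y.
  have -> : y = \row_(i < m) c i.+1 *m K m.
    by rewrite mulmx_sum_row; apply: eq_bigr => i _; rewrite rowK mxE.
  rewrite -[0](mul0mx _ (K m)) (inj_eq (row_free_inj Km)).
  have m_gt0 : (0 < m)%N := leq_ltn_trans (leq0n j) (ltn_ord j).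
  have m1 : (m.-1 < m)%N by rewrite prednK.
  apply/eqP=> /rowP/(_ (Ordinal m1)); rewrite !mxE /= prednK // /c tE.
  exact/eqP.
have Tsum (b : nat -> k) : T (\sum_(i < m) b i *: v i) = \sum_(i < m) psi (b i) *: v i.+1.
  rewrite /T raddf_sum mulmx_suml; apply: eq_bigr => i _.
  by rewrite scalemxAl -map_mxZ.
rewrite [LHS](Tsum (fun i => c i.+1)).
have -> : y = \sum_(i < m) psi (c i) *: v i + psi t *: v m.
  rewrite vmE scaler_sumr -big_split; apply: eq_bigr => i _.
  by rewrite cS scalerDl scalerA.
have <- : c m = t by [].
(* The term in [v m] extends the sum to m+1 terms, and dropping the zero first term gives back
   T(y). *)
rewrite -(big_ord_recr m (fun i => psi (c i) *: v i)) big_ord_recl /= c0.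
by rewrite rmorph0 scale0r add0r.
Qed.

(** The polynomial X^Q - aX - d is nonconstant. The case a = 0 provides Q-th roots. *)
Lemma artin_schreier_root a d : exists b, psi b = a * b + d.
Proof.
have : size ('X^Q - (a *: 'X + d%:P)) != 1%N.
  rewrite size_polyDl ?size_polyXn; first by lia.
  rewrite size_polyN (leq_ltn_trans (size_polyD _ _)) // gtn_max.
  rewrite (leq_ltn_trans (size_scale_leq _ _)) ?size_polyX //.
  by rewrite size_polyC; case: (d != 0); lia.
case/closed_rootP=> b; rewrite /root !hornerE subr_eq0 => /eqP bE; exists b.
by rewrite psiE.
Qed.

Lemma artin_schreier_col n (d : 'cV[k]_n) : exists r, map_mx psi r + d = r.
Proof.
have [f fE] := fin_all_exists (fun i => artin_schreier_root 1 (- d i 0)).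
by exists (\col_i f i); apply/colP=> i; rewrite !mxE fE mul1r subrK.
Qed.

(** A fixed row completed to a basis turns the first row of [N] into (1, 0). Induction solves the
    lower right block, and the remaining column satisfies Artin-Schreier equations. *)
Lemma lang n (N : 'M[k]_n) : N \in unitmx ->
  exists2 R : 'M_n, R \in unitmx & map_mx psi R *m N = R.
Proof.
elim: n N => [|n IHn] N Nu.
  by exists 1%:M; [apply: unitmx1 | apply/matrixP => -[]].
have [x x0 xE] := fixed_vector Nu.
have [G Gu GE] := complete_row x0.
(* Twisted conjugation: a solution [R2] for [N1] gives the solution [R2 *m G] for [N]. *)
pose N1 := map_mx psi G *m N *m invmx G.
have N1u : N1 \in unitmx by rewrite !unitmx_mul map_unitmx Gu Nu unitmx_inv Gu.
have N1E : usubmx N1 = row_mx 1%:M 0.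
  rewrite -!mul_usub_mx -map_usubmx GE xE -GE mul_usub_mx mulmxV //.
  by rewrite scalar_mx_block block_mxEv col_mxKu.
have {}N1u : drsubmx N1 \in unitmx.
  move: N1u; rewrite -[N1]submxK /ulsubmx /ursubmx N1E row_mxKl row_mxKr.
  by rewrite !unitmxE det_lblock det1 mul1r block_mxKdr.
have [R Ru RE] := IHn _ N1u.
pose d := map_mx psi R *m dlsubmx N1.
have [r rE] := artin_schreier_col d.
pose R2 : 'M[k]_(1 + n) := block_mx 1%:M 0 r R.
have R2u : R2 \in unitmx by rewrite unitmxE det_lblock det1 mul1r -unitmxE.
have R2E : map_mx psi R2 *m N1 = R2.
  rewrite -[N1]submxK /ulsubmx /ursubmx N1E row_mxKl row_mxKr /R2.
  rewrite map_block_mx map_mx1 map_mx0 mulmx_block !mul1mx !mul0mx mulmx0.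
  by rewrite mulmx1 !addr0 add0r RE -/d rE.
exists (R2 *m G); first by rewrite unitmx_mul R2u.
by rewrite map_mxM -[RHS](congr1 (mulmx^~ G) R2E) /= /N1 !mulmxA mulmxKV.
Qed.

End Lang.

(** * Fermat form of a Frobenius form *)

Section Fermat.

Variables (k : closedFieldType) (q : nat) (phi : {rmorphism k -> k}).
Hypotheses (phiE : forall x, phi x = x ^+ q) (q_gt1 : (1 < q)%N).

Local Notation "A ^F" := (map_mx phi A) (at level 2, format "A ^F").

Lemma lang2 n (N : 'M[k]_n) : N \in unitmx ->
  exists2 R : 'M_n, R \in unitmx & R^F^F *m N = R.
Proof.
move=> Nu; have [||R Ru RE] := @lang k (q * q) (phi \o phi) _ _ n N Nu.
- by move=> x /=; rewrite !phiE exprM.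
- by nia.
by exists R; rewrite // -map_mx_comp.
Qed.

Lemma delta_form n (H : 'M[k]_n) i j :
  delta_mx 0 i *m H *m (delta_mx 0 j)^T = (H i j)%:M :> 'M_1.
Proof.
by apply/rowP=> s; rewrite trmx_delta -rowE -colE !mxE !ord1.
Qed.

Lemma scalar_mx11_eq0 (a : k) : (a%:M == 0 :> 'M_1) = (a == 0).
Proof.
by apply/eqP/eqP => [/matrixP/(_ 0 0)|->]; rewrite ?raddf0 // !mxE.
Qed.

(* On the solutions x of x^(q^2) A^(q) = x A^T, an F_(q^2)-form of k^n by Lang's
   theorem, x^(q) A y^T is a Hermitian form. *)
Lemma special_vector n (A : 'M[k]_n.+1) : A \in unitmx ->
  exists2 x : 'rV_n.+1, x^F^F *m A^F = x *m A^T & x^F *m A *m x^T = 1%:M.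
Proof.
move=> Au.
have [|R Ru RE] := @lang2 _ (A^F *m invmx A^T).
  by rewrite unitmx_mul map_unitmx Au unitmx_inv unitmx_tr.
have {}RE : R^F^F *m A^F = R *m A^T.
  by rewrite -[in RHS]RE mulmxA mulmxKV // unitmx_tr.
pose H := R^F *m A *m R^T.
have HF i j : phi (H i j) = H j i.
  suff: H^F = H^T by move/matrixP/(_ i j); rewrite !mxE.
  by rewrite !map_mxM RE !trmx_mul trmxK map_trmx mulmxA.
have Hu : H \in unitmx by rewrite !unitmx_mul map_unitmx unitmx_tr Ru Au.
(* A vector over F_(q^2) that is not isotropic for [H]: a basis vector, or, if the diagonal
   vanishes, e_i + (w / H_ij) e_j with w + w^q = 1, on which the form takes the value 1. *)
have [z zF zH] : exists2 z : 'rV_n.+1, z^F^F = z & z^F *m H *m z^T != 0.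
  have [i Hi|Hd] := pickP (fun i => H i i != 0).
    exists (delta_mx 0 i); first by rewrite !map_delta_mx.
    by rewrite map_delta_mx delta_form scalar_mx11_eq0.
  have [[i j] /= Hij|H0] := pickP (fun ij => H ij.1 ij.2 != 0); last first.
    suff H00 : H = 0 by move: Hu; rewrite H00 unitmxE det0 unitr0.
    by apply/matrixP=> i j; rewrite [RHS]mxE; apply/eqP/negbFE/(H0 (i, j)).
  have [w wE] := artin_schreier_root phiE q_gt1 (-1) 1.
  have ww : phi (phi w) = w by rewrite wE rmorphD rmorphM rmorphN1 rmorph1 wE; ring.
  have phi0 x : (phi x == 0) = (x == 0) by rewrite fmorph_eq0.
  exists (delta_mx 0 i + (w / H i j) *: delta_mx 0 j).
    rewrite !(map_mxD, map_mxZ, map_delta_mx); congr (_ + _ *: _).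
    by rewrite !(rmorphM, fmorphV) !HF ww.
  have trD u v c : (u + c *: v)^T = u^T + c *: v^T :> 'cV[k]_n.+1.
    by rewrite linearD linearZ.
  rewrite !(map_mxD, map_mxZ, map_delta_mx) trD !mulmxDl !mulmxDr.
  rewrite -!scalemxAl -!scalemxAr !delta_form.
  move: (negbFE (Hd i)) (negbFE (Hd j)) => /eqP-> /eqP->.
  have -> : phi (w / H i j) *: (H j i)%:M = (phi w)%:M :> 'M_1.
    by rewrite scale_scalar_mx rmorphM fmorphV HF divfK // -HF phi0.
  have -> : (w / H i j) *: (H i j)%:M = w%:M :> 'M_1.
    by rewrite scale_scalar_mx divfK.
  rewrite raddf0 scaler0 !add0r scaler0 addr0 -raddfD wE.
  by rewrite mulN1r addNKr scalar_mx11_eq0 oner_eq0.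
have [x0 [r [x0F r0 rE]]] : exists (x0 : 'rV_n.+1) r,
    [/\ x0^F^F *m A^F = x0 *m A^T, r != 0 & x0^F *m A *m x0^T = r%:M].
  exists (z *m R), ((z^F *m H *m z^T) 0 0); split.
  - by rewrite !map_mxM zF -mulmxA RE mulmxA.
  - by rewrite -scalar_mx11_eq0 -mx11_scalar.
  - by rewrite -mx11_scalar map_mxM trmx_mul !mulmxA.
have rF : phi r = r.
  have := congr1 (map_mx phi) rE; rewrite !map_mxM x0F.
  have -> : x0 *m A^T *m x0^T^F = (x0^F *m A *m x0^T)^T.
    by rewrite !trmx_mul trmxK map_trmx mulmxA.
  by rewrite rE tr_scalar_mx map_scalar_mx => /matrixP/(_ 0 0); rewrite !mxE.
(* Scaling by [l] multiplies the value [r] by l^(q+1). As [r] is fixed by [phi], such an [l] lies in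
   F_(q^2), so the scaled vector still satisfies the first equation. *)
have [l lE] : exists l, phi l * l = r^-1.
  have : size ('X^(q.+1) - (r^-1)%:P) != 1%N.
    by rewrite size_XnsubC // eqSS gtn_eqF // ltnW.
  case/closed_rootP=> l; rewrite /root !hornerE subr_eq0 => /eqP <-; exists l.
  by rewrite phiE exprSr.
have l0 : phi l != 0.
  apply/eqP=> l0; move: lE; rewrite l0 mul0r => /eqP.
  by rewrite eq_sym invr_eq0 (negPf r0).
have lF : phi (phi l) = l.
  have := congr1 phi lE; rewrite rmorphM fmorphV rF -lE [RHS]mulrC.
  by move/(mulIf l0).
exists (l *: x0).
  by rewrite !map_mxZ lF -!scalemxAl x0F.
rewrite map_mxZ linearZ /= -!scalemxAl -scalemxAr rE scalerA lE scale_scalar_mx.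
by rewrite mulVf.
Qed.

(** Gram-Schmidt: split off a vector of value 1 and recurse on the complement. *)
Lemma fermat_form n (A : 'M[k]_n) : A \in unitmx ->
  exists2 R : 'M_n, R \in unitmx & R^F *m A *m R^T = 1%:M.
Proof.
elim: n A => [|n IHn] A Au.
  by exists 1%:M; [apply: unitmx1 | apply/matrixP => -[]].
have [x xF xA] := special_vector Au.
have x0 : x != 0.
  apply/eqP=> x0; move: xA; rewrite x0 trmx0 mulmx0 => /matrixP/(_ 0 0).
  by rewrite !mxE; apply/eqP; rewrite eq_sym oner_neq0.
have [G Gu GE] := complete_row x0; pose G2 := dsubmx G.
pose b := x^F *m A *m G2^T; pose c := G2^F *m A *m x^T.
(* The semilinear equation on [x] relates the two off-diagonal blocks, so the single elimination
   matrix [E] clears both. *)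
have cE : c = b^F^T.
  by rewrite !map_mxM xF !trmx_mul map_trmx !trmxK mulmxA.
pose E : 'M_(1 + n) := block_mx 1%:M 0 (- b^T) 1%:M.
have Eu : E \in unitmx by rewrite unitmxE det_lblock !det1 mulr1 unitr1.
pose D := G2^F *m A *m G2^T.
have HE : G^F *m A *m G^T = block_mx 1%:M b c D.
  rewrite -[G]vsubmxK GE -/G2 map_col_mx tr_col_mx mul_col_mx mul_col_row.
  by rewrite xA.
have EHE : (E *m G)^F *m A *m (E *m G)^T = block_mx 1%:M 0 0 (D - c *m b).
  have -> : (E *m G)^F *m A *m (E *m G)^T = E^F *m (G^F *m A *m G^T) *m E^T.
    by rewrite map_mxM trmx_mul !mulmxA.
  rewrite HE map_block_mx tr_block_mx !mulmx_block !map_mx1 map_mx0 map_mxN.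
  rewrite !trmx0 !trmx1 linearN /= trmxK -map_trmx -cE.
  rewrite !mul1mx !mul0mx !mulmx1 !mulmx0 !addr0 mulNmx.
  by rewrite !addNr mul1mx addNr mul0mx add0r addrC.
have Du : D - c *m b \in unitmx.
  have : (block_mx 1%:M 0 0 (D - c *m b) : 'M_(1 + n)) \in unitmx.
    by rewrite -EHE !unitmx_mul map_unitmx unitmx_tr unitmx_mul Eu Gu Au.
  by rewrite !unitmxE det_lblock det1 mul1r.
have [R Ru RE] := IHn _ Du.
pose R2 : 'M_(1 + n) := block_mx 1%:M 0 0 R.
have R2u : R2 \in unitmx by rewrite unitmxE det_lblock det1 mul1r -unitmxE.
exists (R2 *m (E *m G)); first by rewrite !unitmx_mul R2u Eu.
have -> : (R2 *m (E *m G))^F *m A *m (R2 *m (E *m G))^T =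
    R2^F *m ((E *m G)^F *m A *m (E *m G)^T) *m R2^T.
  by rewrite map_mxM trmx_mul !mulmxA.
rewrite EHE map_block_mx tr_block_mx !mulmx_block map_mx1 !map_mx0 !trmx0 trmx1.
rewrite !mul1mx !mul0mx !mulmx1 !mulmx0 !addr0 !add0r RE.
by rewrite mul0mx -scalar_mx_block.
Qed.

End Fermat.

(** * Subspaces as row spans *)

Section RowSpan.

Variable k : fieldType.

Definition rowspan m n (M : 'M[k]_(m, n)) : {vspace 'rV[k]_n} :=
  limg (linfun (mulmxr M : 'rV[k]_m -> 'rV[k]_n)).

Lemma mem_rowspan m n (M : 'M[k]_(m, n)) v : (v \in rowspan M) = (v <= M)%MS.
Proof.
apply/memv_imgP/submxP => [[u _ ->]|[u ->]]; exists u; rewrite ?lfunE ?memvf //.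
Qed.

Lemma dim_rowspan m n (M : 'M[k]_(m, n)) : row_free M -> \dim (rowspan M) = m.
Proof.
move=> Mf; rewrite limg_dim_eq ?dimvf /dim /= ?mul1n //.
apply/eqP; rewrite -subv0; apply/subvP=> u; rewrite memv_cap memv_ker lfunE /=.
case/andP=> _ /eqP uM; rewrite memv0; apply/eqP/(row_free_inj Mf).
by rewrite uM mul0mx.
Qed.

Lemma rowspanP n (l : {vspace 'rV[k]_n}) m : \dim l = m ->
  exists2 M : 'M_(m, n), row_free M & l = rowspan M.
Proof.
move=> <-; pose M : 'M[k]_(\dim l, n) := \matrix_i (vbasis l)`_i.
have ME u : u *m M = \sum_i u 0 i *: (vbasis l)`_i.
  by rewrite mulmx_sum_row; apply: eq_bigr => i _; rewrite rowK.
exists M.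
  rewrite -kermx_eq0; apply/rowV0P=> u /sub_kermxP; rewrite ME => u0.
  apply/rowP=> i; rewrite mxE.
  by have /freeP/(_ (fun i => u 0 i) u0) := basis_free (vbasisP l); apply.
apply/vspaceP=> v; rewrite mem_rowspan; apply/idP/submxP => [vl|[u ->]].
  exists (\row_i coord (vbasis l) i v); rewrite ME [LHS](coord_vbasis vl).
  by apply: eq_bigr => i _; rewrite mxE.
rewrite ME memv_suml // => i _; rewrite memvZ // vbasis_mem // mem_nth //.
by rewrite size_tuple.
Qed.

Lemma rowspan_eq m1 m2 n (M : 'M[k]_(m1, n)) (N : 'M[k]_(m2, n)) :
  (rowspan M = rowspan N) <-> (M :=: N)%MS.
Proof.
split=> [MN|MN]; last by apply/vspaceP=> v; rewrite !mem_rowspan MN.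
apply/eqmxP/andP; split; apply/row_subP=> i; rewrite -mem_rowspan.
  by rewrite -MN mem_rowspan row_sub.
by rewrite MN mem_rowspan row_sub.
Qed.

Lemma rowspan_sub_eq m n (M N : 'M[k]_(m, n)) :
  row_free M -> row_free N -> (M <= N)%MS -> rowspan M = rowspan N.
Proof.
move=> /eqP rM /eqP rN MN; apply/rowspan_eq/eqmxP; rewrite MN.
by have [_ /esym] := mxrank_leqif_sup MN; rewrite rM rN eqxx.
Qed.

Definition skewb n (l m : {vspace 'rV[k]_n}) : bool := (l :&: m == 0)%VS.

Lemma skewbC n (l m : {vspace 'rV[k]_n}) : skewb l m = skewb m l.
Proof. by rewrite /skewb capvC. Qed.

Lemma skewP n (l m : {vspace 'rV[k]_n}) :
  reflect (forall v, v \in l -> v \in m -> v = 0) (skewb l m).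
Proof.
rewrite /skewb -subv0; apply: (iffP subvP) => lm v.
  by move=> vl vm; apply/eqP; rewrite -memv0 lm // memv_cap vl.
by rewrite memv_cap memv0 => /andP[vl vm]; rewrite (lm v).
Qed.

Lemma skewPn n (l m : {vspace 'rV[k]_n}) :
  reflect (exists v, [/\ v != 0, v \in l & v \in m]) (~~ skewb l m).
Proof.
apply: (iffP idP) => [|[v [v0 vl vm]]]; last first.
  by apply: contra v0 => /skewP lm; rewrite (lm v).
rewrite /skewb -vpick0 => v0; exists (vpick (l :&: m)); split=> //.
  by have := memv_pick (l :&: m)%VS; rewrite memv_cap => /andP[].
by have := memv_pick (l :&: m)%VS; rewrite memv_cap => /andP[].
Qed.

Lemma skew_rowspan m1 m2 (M : 'M[k]_(m1, m1 + m2)) (N : 'M[k]_(m2, m1 + m2)) :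
  row_free M -> row_free N ->
  skewb (rowspan M) (rowspan N) = (col_mx M N \in unitmx).
Proof.
move=> /eqP rM /eqP rN; have := mxrank_sum_cap M N; rewrite rM rN.
rewrite addsmxE -row_free_unit /row_free => rE.
have -> : (\rank (col_mx M N) == m1 + m2)%N = ((M :&: N)%MS == 0).
  rewrite -mxrank_eq0; move: (\rank (col_mx M N)) (\rank (M :&: N)) rE; lia.
apply/skewP/rowV0P => MN v.
  by rewrite sub_capmx -!mem_rowspan => /andP[]; apply: MN.
by rewrite !mem_rowspan => vM vN; apply: MN; rewrite sub_capmx vM.
Qed.

End RowSpan.

(** * The projective line *)

Section ProjectiveLine.

Variable k : fieldType.
Implicit Types (u v w : 'rV[k]_2) (o : option k).

Lemma row2P u v : u 0 0 = v 0 0 -> u 0 1 = v 0 1 -> u = v.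
Proof.
move=> e0 e1; apply/rowP=> -[[|[|//]] i].
  by rewrite (_ : Ordinal i = 0) //; apply: val_inj.
by rewrite (_ : Ordinal i = 1) //; apply: val_inj.
Qed.

Definition row2 (a b : k) : 'rV[k]_2 := \row_j [:: a; b]`_j.

Lemma row2E a b : (row2 a b 0 0 = a) * (row2 a b 0 1 = b).
Proof. by rewrite !mxE. Qed.

(* The point [1 : a], or [0 : 1] for None. *)
Definition pt o : 'rV[k]_2 := if o is Some a then row2 1 a else row2 0 1.

Lemma pt_neq0 o : pt o != 0.
Proof.
apply/eqP=> /rowP; case: o => [a|] /=; [move/(_ 0) | move/(_ 1)];
  by rewrite !mxE /=; apply/eqP; apply: oner_neq0.
Qed.

Lemma pt_span u : u != 0 -> exists o c, c != 0 /\ u = c *: pt o.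
Proof.
move=> u0; have [u00|u00] := eqVneq (u 0 0) 0; last first.
  exists (Some (u 0 1 / u 0 0)), (u 0 0); split=> //; apply: row2P.
    by rewrite mxE row2E mulr1.
  by rewrite mxE row2E mulrC divfK.
exists None, (u 0 1); split.
  by apply: contra u0 => /eqP u01; apply/eqP/row2P; rewrite mxE.
by apply: row2P; rewrite mxE row2E ?mulr0 ?mulr1.
Qed.

(** The determinant with rows [u] and [v]; for nonzero vectors it vanishes iff they give the same
    point of P^1. *)
Definition cross u v : k := u 0 0 * v 0 1 - u 0 1 * v 0 0.

Lemma cross_pt o o' : cross (pt o) (pt o') = 0 -> o = o'.
Proof.
rewrite /cross; case: o o' => [a|] [b|] //=; rewrite !row2E !(mul1r, mulr1, mul0r, mulr0).
- by move/subr0_eq=> ->.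
- by rewrite subr0 => /eqP; rewrite oner_eq0.
- by rewrite sub0r => /eqP; rewrite oppr_eq0 oner_eq0.
Qed.

Lemma cross_indep u v a b : cross u v != 0 -> a *: u = b *: v -> a = 0 /\ b = 0.
Proof.
move=> uv ab; have e0 : a * u 0 0 = b * v 0 0.
  by have /rowP/(_ 0) := ab; rewrite !mxE.
have e1 : a * u 0 1 = b * v 0 1 by have /rowP/(_ 1) := ab; rewrite !mxE.
have /eqP : a * cross u v = 0 by rewrite mulrBr !mulrA e0 e1; ring.
have /eqP : b * cross u v = 0.
  have -> : b * cross u v = u 0 0 * (b * v 0 1) - u 0 1 * (b * v 0 0).
    by rewrite /cross; ring.
  by rewrite -e0 -e1; ring.
by rewrite !mulf_eq0 (negPf uv) !orbF => /eqP-> /eqP->.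
Qed.

(** Cramer's rule. *)
Lemma cross_decomp u v w : cross u v != 0 ->
  w = (cross w v / cross u v) *: u + (cross u w / cross u v) *: v.
Proof.
move=> uv; apply: row2P; rewrite !mxE; apply: (mulfI uv); rewrite mulrDr !mulrA.
  rewrite ![cross u v * _]mulrC !mulfK // /cross; ring.
by rewrite ![cross u v * _]mulrC !mulfK // /cross; ring.
Qed.

End ProjectiveLine.

Lemma unitmx2 (k : fieldType) (B : 'M[k]_2) :
  (B \in unitmx) = (B 0 0 * B 1 1 - B 0 1 * B 1 0 != 0).
Proof.
have l0 : lift 0 0 = 1 :> 'I_2 by apply: val_inj.
have l1 : lift 1 0 = 0 :> 'I_2 by apply: val_inj.
rewrite unitmxE unitfE (expand_det_row _ 0) !big_ord_recl big_ord0 addr0.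
rewrite /cofactor !det_mx11 !mxE !l0 !l1.
by rewrite expr0 expr1 mul1r mulN1r mulrN.
Qed.

(** * Counting roots of separable polynomials *)

Section FixedCounts.

Variable k : closedFieldType.

(** The derivative of X^Q - X is -1. *)
Lemma card_fixed (Q : nat) : (1 < Q)%N -> Q%:R = 0 :> k ->
  has_card (fun x : k => x ^+ Q = x) Q.
Proof.
move=> Q1 Q0; have sp : separable_poly ('X^Q - 'X : {poly k}).
  rewrite unlock derivB derivXn derivX -mulr_natr -polyC_natr Q0 mulr0 sub0r.
  by apply/Bezout_eq1_coprimepP; exists (0, -1); rewrite mul0r add0r mulrNN mulr1.
have := has_card_roots sp; rewrite size_polyDl ?size_polyXn; last first.
  by rewrite size_polyN size_polyX.
apply: has_card_ext => x; rewrite /root !hornerE subr_eq0.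
by split=> /eqP.
Qed.

(** Separability comes from the identity B_11 p - (B_11 X + B_10) p' = det B, where p' = B_01 + B_11
    X^q. *)
Lemma card_binary_form (q : nat) (B : 'M[k]_2) (f : option k -> k) :
    (1 < q)%N -> q%:R = 0 :> k -> B \in unitmx ->
    (forall a, f (Some a) = B 0 0 + B 0 1 * a + B 1 0 * a ^+ q + B 1 1 * a ^+ q.+1) ->
    f None = B 1 1 ->
  has_card (fun o => f o = 0) q.+1.
Proof.
move=> q_gt1 q0 Bu fS fN.
have detB : B 0 0 * B 1 1 - B 0 1 * B 1 0 != 0 by rewrite -unitmx2.
pose p : {poly k} := (B 0 0)%:P + B 0 1 *: 'X + B 1 0 *: 'X^q + B 1 1 *: 'X^(q.+1).
have fpE a : root p a <-> f (Some a) = 0.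
  by rewrite fS /root !hornerE; split=> /eqP.
have p'E : p^`() = (B 0 1)%:P + B 1 1 *: 'X^q.
  have Xq0 n : 'X^n *+ q = 0 :> {poly k} by rewrite -scaler_nat q0 scale0r.
  rewrite /p !derivD derivC !derivZ derivX !derivXn mulrS !Xq0.
  by rewrite scaler0 !addr0 add0r alg_polyC.
have sp : separable_poly p.
  rewrite unlock; apply/Bezout_eq1_coprimepP.
  pose d := B 0 0 * B 1 1 - B 0 1 * B 1 0.
  exists ((d^-1 * B 1 1)%:P, - (d^-1)%:P * ((B 1 1) *: 'X + (B 1 0)%:P)).
  rewrite /= p'E /p -!mul_polyC exprS polyCM.
  transitivity ((d^-1)%:P * d%:P : {poly k}).
    by rewrite /d polyCB !polyCM; ring.
  by rewrite -polyCM mulVf.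
have := has_card_roots sp; pose r : {poly k} := (B 0 0)%:P + B 0 1 *: 'X.
have sr : (size r <= 2)%N.
  rewrite (leq_trans (size_polyD _ _)) // geq_max (leq_trans (size_scale_leq _ _)).
    by rewrite size_polyC (leq_trans (leq_b1 _)).
  by rewrite size_polyX.
(* If B_11 = 0, the degree drops to q and the missing zero is the point [None]; otherwise all q+1
   zeros are affine. *)
have [B11|B11] := eqVneq (B 1 1) 0.
  have B10 : B 1 0 != 0 by apply: contraNneq detB => ->; rewrite B11 !mulr0 subr0.
  have -> : size p = q.+1.
    rewrite /p B11 scale0r addr0 addrC size_polyDl ?size_scale ?size_polyXn //.
    by rewrite (leq_ltn_trans sr).
  move=> cp; apply: has_card_option; last by rewrite fN.
  exact: has_card_ext cp.
have -> : size p = q.+2.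
  rewrite /p addrC size_polyDl ?size_scale ?size_polyXn //.
  rewrite (leq_ltn_trans (size_polyD _ _)) // gtn_max; apply/andP; split.
    by rewrite (leq_ltn_trans sr) // ltnS ltnW.
  by rewrite (leq_ltn_trans (size_scale_leq _ _)) ?size_polyXn.
move=> cp; apply: has_card_option0; last by rewrite fN; apply/eqP.
exact: has_card_ext cp.
Qed.

End FixedCounts.

(** * Frames adapted to a pair of skew lines *)

Section Charts.

Variable k : fieldType.

(** The rows of [g] are the frame, and those of [M] are coordinates with respect to it. *)
Definition chart (g : 'M[k]_(2 + 2)) m (M : 'M[k]_(m, 2 + 2)) :=
  rowspan (M *m g).

(* With coordinates (x, y) on k^2 + k^2, the line y = x D; lineX and lineY are the
   lines y = 0 and x = 0, and bridge u v joins the point (u, 0) to (0, v). *)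
Definition graph (D : 'M[k]_2) : 'M[k]_(2, 2 + 2) := row_mx 1%:M D.
Definition lineX : 'M[k]_(2, 2 + 2) := row_mx 1%:M 0.
Definition lineY : 'M[k]_(2, 2 + 2) := row_mx 0 1%:M.
Definition bridge (u v : 'rV[k]_2) : 'M[k]_(1 + 1, 2 + 2) := block_mx u 0 0 v.

Lemma row_free_graph D : row_free (graph D).
Proof.
apply/row_freeP; exists (col_mx 1%:M 0).
by rewrite mul_row_col mulmx0 addr0 mulmx1.
Qed.

Lemma row_free_lineX : row_free lineX. Proof. exact: row_free_graph. Qed.

Lemma row_free_lineY : row_free lineY.
Proof.
apply/row_freeP; exists (col_mx 0 1%:M).
by rewrite mul_row_col mulmx0 add0r mulmx1.
Qed.

Lemma row_free_bridge u v : u != 0 -> v != 0 -> row_free (bridge u v).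
Proof. by move=> u0 v0; rewrite /row_free rank_diag_block_mx !rank_rV u0 v0. Qed.

Lemma sub_bridge (a b u v : 'rV[k]_2) :
  (row_mx a b <= bridge u v)%MS <-> exists s t, a = s *: u /\ b = t *: v.
Proof.
split=> [/submxP[w]|[s [t [-> ->]]]].
  rewrite -[w]hsubmxK /bridge mul_row_block !mulmx0 addr0 add0r => /eq_row_mx[-> ->].
  exists (lsubmx w 0 0), (rsubmx w 0 0).
  by rewrite {1}[lsubmx w]mx11_scalar {1}[rsubmx w]mx11_scalar !mul_scalar_mx.
apply/submxP; exists (row_mx s%:M t%:M).
by rewrite mul_row_block !mulmx0 addr0 add0r !mul_scalar_mx.
Qed.

Variable g : 'M[k]_(2 + 2).
Hypothesis gu : g \in unitmx.

Lemma row_free_chart m (M : 'M[k]_(m, 2 + 2)) : row_free M -> row_free (M *m g).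
Proof. by rewrite /row_free mxrankMfree // row_free_unit. Qed.

Lemma mem_chart m (M : 'M[k]_(m, 2 + 2)) v : (v *m g \in chart g M) = (v <= M)%MS.
Proof. by rewrite mem_rowspan submxMfree // row_free_unit. Qed.

Lemma chart_point (v : 'rV[k]_(2 + 2)) : exists w, v = w *m g.
Proof. by exists (v *m invmx g); rewrite mulmxKV. Qed.

Lemma chart_surj (l : {vspace 'rV[k]_(2 + 2)}) : \dim l = 2%N ->
  exists2 M : 'M_(2, 2 + 2), row_free M & l = chart g M.
Proof.
move/rowspanP=> [M Mf ->]; exists (M *m invmx g); last by rewrite /chart mulmxKV.
by move: Mf; rewrite /row_free mxrankMfree // row_free_unit unitmx_inv.
Qed.

Lemma dim_chart m (M : 'M[k]_(m, 2 + 2)) : row_free M -> \dim (chart g M) = m.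
Proof. by move/row_free_chart; apply: dim_rowspan. Qed.

Lemma skew_chart (M N : 'M[k]_(2, 2 + 2)) : row_free M -> row_free N ->
  skewb (chart g M) (chart g N) = (col_mx M N \in unitmx).
Proof.
move=> Mf Nf; rewrite skew_rowspan ?row_free_chart // -mul_col_mx unitmx_mul.
by rewrite gu andbT.
Qed.

Lemma meet_chart m n (M : 'M[k]_(m, 2 + 2)) (N : 'M[k]_(n, 2 + 2)) :
  ~~ skewb (chart g M) (chart g N) <->
  exists v : 'rV_(2 + 2), [/\ v != 0, (v <= M)%MS & (v <= N)%MS].
Proof.
split=> [/skewPn[v [v0]]|[v [v0 vM vN]]].
  have [w wE] := chart_point v; rewrite wE !mem_chart => wM wN.
  by exists w; split=> //; apply: contraNneq v0 => w0; rewrite wE w0 mul0mx.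
apply/skewPn; exists (v *m g); rewrite !mem_chart; split=> //.
apply: contraNneq v0 => vg0; apply/eqP/(row_free_inj (A := g)).
  by rewrite row_free_unit.
by rewrite vg0 mul0mx.
Qed.

Lemma chart_sub_eq (M N : 'M[k]_(2, 2 + 2)) :
  row_free M -> row_free N -> (M <= N)%MS -> chart g M = chart g N.
Proof.
by move=> Mf Nf MN; apply: rowspan_sub_eq; rewrite ?row_free_chart ?submxMr.
Qed.

Lemma chart_eq_sub m n (M : 'M[k]_(m, 2 + 2)) (N : 'M[k]_(n, 2 + 2)) :
  chart g M = chart g N -> (M <= N)%MS.
Proof.
by move/rowspan_eq=> MN; rewrite -(submxMfree _ _ (C := g)) ?row_free_unit // MN.
Qed.

(** The line is spanned by its points on the two coordinate lines; the first is normalised to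
    [pt o], so that [o] can index the transversals. *)
Lemma transversal_chart (z : {vspace 'rV[k]_(2 + 2)}) : \dim z = 2%N ->
    ~~ skewb (chart g lineX) z -> ~~ skewb (chart g lineY) z ->
  exists o v, v != 0 /\ z = chart g (bridge (pt o) v).
Proof.
move=> /chart_surj[M Mf ->] /meet_chart[v1 [v10 /submxP[u uE] v1M]].
move=> /meet_chart[v2 [v20 /submxP[v vE] v2M]].
have {}uE : v1 = row_mx u 0 by rewrite uE mul_mx_row mulmx1 mulmx0.
have {}vE : v2 = row_mx 0 v by rewrite vE mul_mx_row mulmx1 mulmx0.
have u0 : u != 0 by apply: contraNneq v10 => u0; rewrite uE u0 row_mx0.
have v0 : v != 0 by apply: contraNneq v20 => v0; rewrite vE v0 row_mx0.
have [o [c [c0 uc]]] := pt_span u0; exists o, v; split=> //; apply/esym.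
have sM : (bridge (pt o) v <= M)%MS.
  rewrite /bridge block_mxEv col_mx_sub -vE v2M andbT.
  have -> : row_mx (pt o) 0 = c^-1 *: v1.
    by rewrite uE scale_row_mx scaler0 uc scalerA mulVf // scale1r.
  exact: scalemx_sub.
exact: chart_sub_eq (row_free_bridge (pt_neq0 o) v0) Mf sM.
Qed.

Lemma bridge_inj o o' v v' :
  chart g (bridge (pt o) v) = chart g (bridge (pt o') v') -> o = o'.
Proof.
move/chart_eq_sub; rewrite {1}/bridge block_mxEv col_mx_sub => /andP[+ _].
by case/sub_bridge=> s [t [uE _]]; apply: cross_pt; rewrite uE /cross !mxE; ring.
Qed.

Lemma skew_bridge u v u' v' : cross u u' != 0 -> cross v v' != 0 ->
  skewb (chart g (bridge u v)) (chart g (bridge u' v')).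
Proof.
move=> uu' vv'; apply/negPn/negP => /meet_chart[w [w0]].
rewrite -[w]hsubmxK => /sub_bridge[s [t [aE bE]]] /sub_bridge[s' [t' [aE' bE']]].
case/eqP: w0; rewrite -[w]hsubmxK.
have [s0 _] := cross_indep uu' (etrans (esym aE) aE').
have [t0 _] := cross_indep vv' (etrans (esym bE) bE').
by rewrite aE bE s0 t0 !scale0r row_mx0.
Qed.

Lemma bridge_meets u v : u != 0 -> v != 0 ->
  ~~ skewb (chart g lineX) (chart g (bridge u v)) /\
  ~~ skewb (chart g lineY) (chart g (bridge u v)).
Proof.
move=> u0 v0; split; apply/meet_chart.
  exists (row_mx u 0); split.
  - by apply: contraNneq u0 => /(congr1 lsubmx); rewrite row_mxKl linear0 => ->.
  - by apply/submxP; exists u; rewrite mul_mx_row mulmx1 mulmx0.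
  - by apply/sub_bridge; exists 1, 0; rewrite scale1r scale0r.
exists (row_mx 0 v); split.
- by apply: contraNneq v0 => /(congr1 rsubmx); rewrite row_mxKr linear0 => ->.
- by apply/submxP; exists v; rewrite mul_mx_row mulmx1 mulmx0.
- by apply/sub_bridge; exists 0, 1; rewrite scale1r scale0r.
Qed.

End Charts.

(** * Isotropic lines, and the form in a frame given by two skew lines *)

Section Isotropic.

Variables (k : closedFieldType) (q : nat) (phi : {rmorphism k -> k}).
Hypotheses (phiE : forall x, phi x = x ^+ q) (q_gt1 : (1 < q)%N).

Local Notation "A ^F" := (map_mx phi A) (at level 2, format "A ^F").

(** Polarisation: evaluating at e_i + c e_j gives c^q S_ji + c S_ij = 0. Comparing c = 1 with a
    solution of c^q = c + 1 leaves S_ji = 0. *)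
Lemma form_eq0 m (S : 'M[k]_m) :
  (forall u : 'rV_m, u^F *m S *m u^T = 0) -> S = 0.
Proof.
move=> S0; have Sd i : S i i = 0.
  have := S0 (delta_mx 0 i); rewrite map_delta_mx delta_form => /eqP.
  by rewrite scalar_mx11_eq0 => /eqP.
have Sc i j c : phi c * S j i + c * S i j = 0.
  have := S0 (delta_mx 0 i + c *: delta_mx 0 j).
  have -> : (delta_mx 0 i + c *: delta_mx 0 j : 'rV[k]_m)^T =
      (delta_mx 0 i)^T + c *: (delta_mx 0 j)^T by rewrite linearD linearZ.
  rewrite map_mxD map_mxZ !map_delta_mx !mulmxDl !mulmxDr -!scalemxAl -!scalemxAr.
  rewrite !delta_form !Sd raddf0 !scaler0 add0r addr0 !scale_scalar_mx -raddfD.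
  by move/eqP; rewrite scalar_mx11_eq0 addrC => /eqP.
apply/matrixP=> i j; rewrite mxE.
have [c cE] := artin_schreier_root phiE q_gt1 1 1.
have := Sc i j c; rewrite cE mul1r; have := Sc i j 1; rewrite rmorph1 !mul1r.
move=> /eqP; rewrite addrC addr_eq0 => /eqP ->.
by rewrite mulrDl mulrN addrAC subrr add0r mul1r => ->; rewrite oppr0.
Qed.

Definition on_surface n (A : 'M[k]_n) (l : {vspace 'rV[k]_n}) : Prop :=
  \dim l = 2%N /\ forall v, v \in l -> v^F *m A *m v^T = 0.

Lemma on_rowspan m n (A : 'M[k]_n) (M : 'M[k]_(m, n)) :
  (forall v, v \in rowspan M -> v^F *m A *m v^T = 0) <-> M^F *m A *m M^T = 0.
Proof.
split=> MA.
  apply: form_eq0 => u; have := MA (u *m M); rewrite mem_rowspan submxMl.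
  by rewrite map_mxM trmx_mul !mulmxA => ->.
move=> v; rewrite mem_rowspan => /submxP[u ->]; rewrite map_mxM trmx_mul.
have -> : u^F *m M^F *m A *m (M^T *m u^T) = u^F *m (M^F *m A *m M^T) *m u^T.
  by rewrite !mulmxA.
by rewrite MA mulmx0 mul0mx.
Qed.

Variable A : 'M[k]_(2 + 2).
Hypothesis Au : A \in unitmx.

Lemma on_chart g (M : 'M[k]_(2, 2 + 2)) : g \in unitmx -> row_free M ->
  on_surface A (chart g M) <-> M^F *m (g^F *m A *m g^T) *m M^T = 0.
Proof.
move=> gu Mf; have -> : M^F *m (g^F *m A *m g^T) *m M^T = (M *m g)^F *m A *m (M *m g)^T.
  by rewrite map_mxM trmx_mul !mulmxA.
rewrite -on_rowspan; split=> [[]//|MA]; split=> //.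
by rewrite dim_chart.
Qed.

Lemma form_graph (B C D : 'M[k]_2) :
  (graph D)^F *m block_mx 0 B C 0 *m (graph D)^T = B *m D^T + D^F *m C.
Proof.
rewrite map_row_mx tr_row_mx map_mx1 trmx1 mul_row_block mul_row_col.
by rewrite !mul1mx !mulmx0 add0r addr0 mulmx1 addrC.
Qed.

Lemma form_bridge (B C : 'M[k]_2) (u v : 'rV_2) :
  (bridge u v)^F *m block_mx 0 B C 0 *m (bridge u v)^T =
  block_mx 0 (u^F *m B *m v^T) (v^F *m C *m u^T) 0.
Proof.
rewrite map_block_mx tr_block_mx !map_mx0 !trmx0 !mulmx_block.
by rewrite !(mul0mx, mulmx0, addr0, add0r).
Qed.

Lemma on_bridge (B C : 'M[k]_2) g u v : g \in unitmx ->
    g^F *m A *m g^T = block_mx 0 B C 0 -> u != 0 -> v != 0 ->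
  on_surface A (chart g (bridge u v)) <->
    u^F *m B *m v^T = 0 /\ v^F *m C *m u^T = 0.
Proof.
move=> gu gE u0 v0; rewrite (on_chart gu (row_free_bridge u0 v0)) gE.
have bE := form_bridge B C u v; split=> [E|[uv vu]]; last first.
  by apply: (etrans bE); rewrite uv vu block_mx0.
have /eqP := etrans (esym bE) E.
by rewrite block_mx_eq0 => /and4P[_ /eqP-> /eqP-> _].
Qed.

(** Bases of the two lines together form the frame; the diagonal blocks vanish because both lines
    lie on the surface. *)
Lemma skew_pair_chart l m : on_surface A l -> on_surface A m -> skewb l m ->
  exists g B C, [/\ g \in unitmx, l = chart g (lineX k), m = chart g (lineY k)
    & [/\ B \in unitmx, C \in unitmx & g^F *m A *m g^T = block_mx 0 B C 0]].
Proof.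
move=> [/rowspanP[M Mf ->] /on_rowspan MA] [/rowspanP[N Nf ->] /on_rowspan NA].
rewrite (skew_rowspan (m1 := 2) (m2 := 2)) // => gu.
pose g : 'M[k]_(2 + 2) := col_mx M N.
pose B := M^F *m A *m N^T; pose C := N^F *m A *m M^T.
have gE : g^F *m A *m g^T = block_mx 0 B C 0.
  by rewrite map_col_mx tr_col_mx mul_col_mx mul_col_row MA NA.
have : block_mx 0 B C 0 \in unitmx by rewrite -gE !unitmx_mul map_unitmx unitmx_tr gu Au.
(* Factoring out the swap of the two halves leaves a block-diagonal matrix, from which invertibility
   of [B] and [C] is read off. *)
have -> : block_mx 0 B C 0 = block_mx B 0 0 C *m block_mx 0 1%:M 1%:M 0.
  by rewrite mulmx_block !(mul0mx, mulmx0, mulmx1, addr0, add0r).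
rewrite unitmx_mul => /andP[+ _]; rewrite unitmxE det_lblock unitrM -!unitmxE.
case/andP=> Bu Cu; exists g, B, C; split=> //.
  by rewrite /chart mul_row_col mul1mx mul0mx addr0.
by rewrite /chart mul_row_col mul1mx mul0mx add0r.
Qed.

End Isotropic.

(** * Graphs, bridges and reguli in a frame *)

Section MoreCharts.

Variable k : fieldType.

Lemma chart_diag (P R : 'M[k]_2) g : P \in unitmx -> R \in unitmx ->
  chart (block_mx P 0 0 R *m g) (lineX k) = chart g (lineX k) /\
  chart (block_mx P 0 0 R *m g) (lineY k) = chart g (lineY k).
Proof.
move=> Pu Ru.
have EX : lineX k *m block_mx P 0 0 R = P *m lineX k.
  rewrite /lineX mul_row_block mul_mx_row !mul1mx !mul0mx !mulmx1 !mulmx0.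
  by rewrite !addr0.
have EY : lineY k *m block_mx P 0 0 R = R *m lineY k.
  rewrite /lineY mul_row_block mul_mx_row !mul1mx !mul0mx !mulmx1 !mulmx0.
  by rewrite !add0r.
split; apply/rowspan_eq; rewrite mulmxA ?EX ?EY -mulmxA; apply: eqmxMfull;
  by rewrite row_full_unit.
Qed.

Variable g : 'M[k]_(2 + 2).
Hypothesis gu : g \in unitmx.

Lemma skew_lineY (P R : 'M[k]_2) : row_free (row_mx P R) ->
  skewb (chart g (lineY k)) (chart g (row_mx P R)) = (P \in unitmx).
Proof.
move=> PRf; rewrite skewbC skew_chart ?row_free_lineY //.
by rewrite -block_mxEv unitmxE det_ublock det1 mulr1.
Qed.

Lemma skew_lineX (P R : 'M[k]_2) : row_free (row_mx P R) ->
  skewb (chart g (lineX k)) (chart g (row_mx P R)) = (R \in unitmx).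
Proof.
move=> PRf; rewrite skew_chart ?row_free_lineX //.
by rewrite -block_mxEv unitmxE det_lblock det1 mul1r.
Qed.

Lemma graph_surj (z : {vspace 'rV[k]_(2 + 2)}) : \dim z = 2%N ->
  skewb (chart g (lineY k)) z -> exists D, z = chart g (graph D).
Proof.
move=> /(chart_surj gu)[M]; rewrite -[M]hsubmxK => Mf ->.
rewrite skew_lineY // => Pu; exists (invmx (lsubmx M) *m rsubmx M).
apply/esym/chart_sub_eq; rewrite ?row_free_graph //.
apply/submxP; exists (invmx (lsubmx M)).
by rewrite mul_mx_row mulVmx.
Qed.

Lemma graph_inj (D D' : 'M[k]_2) :
  chart g (graph D) = chart g (graph D') -> D = D'.
Proof.
move/(chart_eq_sub gu) => /submxP[S]; rewrite mul_mx_row mulmx1 => /eq_row_mx[<-].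
by rewrite mul1mx.
Qed.

Lemma bridge_scale (c : k) (u v : 'rV[k]_2) : c != 0 -> u != 0 -> v != 0 ->
  chart g (bridge u (c *: v)) = chart g (bridge u v).
Proof.
move=> c0 u0 v0; have cv0 : c *: v != 0 by rewrite scaler_eq0 negb_or c0.
have sub : (bridge u (c *: v) <= bridge u v)%MS.
  rewrite {1}/bridge block_mxEv col_mx_sub; apply/andP; split; apply/sub_bridge.
    by exists 1, 0; rewrite scale1r scale0r.
  by exists 0, c; rewrite scale0r.
exact: chart_sub_eq (row_free_bridge u0 cv0) (row_free_bridge u0 v0) sub.
Qed.

Lemma bridge_diag (u v : 'rV[k]_2) : u != 0 -> v != 0 ->
  ~~ skewb (chart g (graph 1%:M)) (chart g (bridge u v)) <->
  exists2 c, c != 0 & v = c *: u.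
Proof.
move=> u0 v0; split=> [/(meet_chart gu)[w [w0 /submxP[x]]]|[c c0 vE]].
  rewrite mul_mx_row !mulmx1 => wE; rewrite wE => /sub_bridge[s [t [xs xt]]].
  have x0 : x != 0 by apply: contraNneq w0 => x0; rewrite wE x0 row_mx0.
  have s0 : s != 0 by apply: contraNneq x0 => s0; rewrite xs s0 scale0r.
  have t0 : t != 0 by apply: contraNneq x0 => t0; rewrite xt t0 scale0r.
  exists (t^-1 * s); first by rewrite mulf_neq0 ?invr_eq0.
  by rewrite -scalerA -xs xt scalerA mulVf // scale1r.
apply/(meet_chart gu); exists (row_mx v v); split.
- by apply: contraNneq v0 => /(congr1 lsubmx); rewrite row_mxKl linear0 => ->.
- by apply/submxP; exists v; rewrite mul_mx_row mulmx1.
- by apply/sub_bridge; exists c, 1; rewrite scale1r.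
Qed.

Lemma cross0_scale (u v : 'rV[k]_2) : u != 0 -> v != 0 -> cross u v = 0 ->
  exists2 c, c != 0 & v = c *: u.
Proof.
move=> /pt_span[o [c [c0 ->]]] /pt_span[o' [c' [c'0 ->]]] E.
have /cross_pt-> : cross (pt o) (pt o') = 0.
  have : (c * c') * cross (pt o) (pt o') = 0 by rewrite -E /cross !mxE; ring.
  by move/eqP; rewrite !mulf_eq0 (negPf c0) (negPf c'0) => /eqP.
exists (c' / c); first by rewrite mulf_neq0 ?invr_eq0.
by rewrite scalerA divfK.
Qed.

(* A line meeting three bridges b_1, b_2, b_3 of a regulus consists of the vectors
   (s u, t u) for a fixed [s : t], so it meets all bridges. *)
Lemma regulus_chart (o o1 o2 o3 : option k) (a : {vspace 'rV[k]_(2 + 2)}) :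
    \dim a = 2%N -> o1 != o2 -> o2 != o3 -> o3 != o1 ->
    ~~ skewb a (chart g (bridge (pt o1) (pt o1))) ->
    ~~ skewb a (chart g (bridge (pt o2) (pt o2))) ->
    ~~ skewb a (chart g (bridge (pt o3) (pt o3))) ->
  ~~ skewb a (chart g (bridge (pt o) (pt o))).
Proof.
move=> /(chart_surj gu)[M Mf ->] n12 n23 n31.
have cr (o' o'' : option k) : o' != o'' -> cross (pt o') (pt o'') != 0.
  by apply: contra => /eqP/cross_pt->.
have cr12 := cr _ _ n12; have cr23 := cr _ _ n23; have cr31 := cr _ _ n31.
move=> /(meet_chart gu)[p1 [p10 p1M]]; rewrite -[p1]hsubmxK.
move=> /sub_bridge[s1 [t1 [p1l p1r]]].
move=> /(meet_chart gu)[p2 [p20 p2M]]; rewrite -[p2]hsubmxK.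
move=> /sub_bridge[s2 [t2 [p2l p2r]]].
move=> /(meet_chart gu)[p3 [p30 p3M]]; rewrite -[p3]hsubmxK.
move=> /sub_bridge[s3 [t3 [p3l p3r]]].
have e1 : p1 = row_mx (s1 *: pt o1) (t1 *: pt o1) by rewrite -p1l -p1r hsubmxK.
have e2 : p2 = row_mx (s2 *: pt o2) (t2 *: pt o2) by rewrite -p2l -p2r hsubmxK.
have e3 : p3 = row_mx (s3 *: pt o3) (t3 *: pt o3) by rewrite -p3l -p3r hsubmxK.
(* Points on two distinct bridges of the regulus are independent, so [p1] and [p2] span the line. *)
have p12 : row_free (col_mx p1 p2).
  rewrite -kermx_eq0; apply/rowV0P=> x /sub_kermxP.
  rewrite -[x]hsubmxK mul_row_col [lsubmx x]mx11_scalar [rsubmx x]mx11_scalar.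
  rewrite !mul_scalar_mx e1 e2 !scale_row_mx add_row_mx !scalerA.
  set x1 := lsubmx x 0 0; set x2 := rsubmx x 0 0.
  move/eqP; rewrite row_mx_eq0 => /andP[/eqP/addr0_eq + /eqP/addr0_eq].
  rewrite -!scaleNr => /(cross_indep cr12)[s10 s20] /(cross_indep cr12)[t10 t20].
  have x10 : x1 = 0.
    apply/eqP; apply: contraNT p10 => x1n; rewrite e1.
    move/eqP: s10; rewrite oppr_eq0 mulf_eq0 (negPf x1n) /= => /eqP->.
    move/eqP: t10; rewrite oppr_eq0 mulf_eq0 (negPf x1n) /= => /eqP->.
    by rewrite !scale0r row_mx0.
  have x20 : x2 = 0.
    apply/eqP; apply: contraNT p20 => x2n; rewrite e2.
    move/eqP: s20; rewrite mulf_eq0 (negPf x2n) /= => /eqP->.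
    move/eqP: t20; rewrite mulf_eq0 (negPf x2n) /= => /eqP->.
    by rewrite !scale0r row_mx0.
  by rewrite x10 x20 raddf0 row_mx0.
have M12 : (M <= col_mx p1 p2)%MS.
  have p12M : (col_mx p1 p2 <= M)%MS by rewrite col_mx_sub p1M.
  by apply/(chart_eq_sub gu)/esym/(chart_sub_eq gu p12 Mf p12M).
have /submxP[w] := submx_trans p3M M12.
rewrite -[w]hsubmxK mul_row_col [lsubmx w]mx11_scalar [rsubmx w]mx11_scalar.
rewrite !mul_scalar_mx e1 e2 e3 !scale_row_mx add_row_mx !scalerA.
set x1 := lsubmx w 0 0; set x2 := rsubmx w 0 0 => /eq_row_mx[sE tE].
pose u1 := pt o1; pose u2 := pt o2.
pose al := cross (pt o3) u2 / cross u1 u2; pose be := cross u1 (pt o3) / cross u1 u2.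
have al0 : al != 0 by rewrite mulf_neq0 ?invr_eq0 // cr // eq_sym.
have be0 : be != 0 by rewrite mulf_neq0 ?invr_eq0 // cr // eq_sym.
have u3E : pt o3 = al *: u1 + be *: u2 by apply: cross_decomp.
(* Applied to both halves of [p3] written through [p1] and [p2], this shows that [s1 : t1] and
   [s2 : t2] agree with [s3 : t3] wherever the coefficients are nonzero, and that neither
   coefficient vanishes. *)
have coef r3 r1 r2 : r3 *: pt o3 = r1 *: u1 + r2 *: u2 -> r1 = r3 * al /\ r2 = r3 * be.
  rewrite u3E scalerDr !scalerA => E.
  have : (r3 * al - r1) *: u1 = (r2 - r3 * be) *: u2.
    rewrite !scalerBl; apply: (addIr (r1 *: u1 + (r3 * be) *: u2)).
    by rewrite addrA subrK E [RHS]addrC -[RHS]addrA [X in _ = _ + X]addrCA subrr addr0.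
  by case/(cross_indep cr12) => /subr0_eq-> /subr0_eq->.
have [s31 s32] := coef _ _ _ sE; have [t31 t32] := coef _ _ _ tE.
pose ga := cross (pt o) u2 / cross u1 u2; pose de := cross u1 (pt o) / cross u1 u2.
have uE : pt o = ga *: u1 + de *: u2 by apply: cross_decomp.
apply/(meet_chart gu); exists (row_mx (s3 *: pt o) (t3 *: pt o)); split.
- apply: contraNneq p30 => /eqP; rewrite row_mx_eq0 !scaler_eq0 !(negPf (pt_neq0 _)).
  by rewrite !orbF e3 => /andP[/eqP-> /eqP->]; rewrite !scale0r row_mx0.
(* Since x1 s1 = s3 al and x2 s2 = s3 be, and likewise for the t's, these coefficients turn the
   coordinates (al, be) of [pt o3] into those of [pt o]. *)
- have -> : row_mx (s3 *: pt o) (t3 *: pt o) =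
      (ga * x1 / al) *: p1 + (de * x2 / be) *: p2.
    rewrite e1 e2 !scale_row_mx add_row_mx uE !scalerDr !scalerA.
    congr (row_mx (_ *: _ + _ *: _) (_ *: _ + _ *: _)).
    + by rewrite mulrAC -[ga * x1 * s1]mulrA s31; field.
    + by rewrite mulrAC -[de * x2 * s2]mulrA s32; field.
    + by rewrite mulrAC -[ga * x1 * t1]mulrA t31; field.
    + by rewrite mulrAC -[de * x2 * t2]mulrA t32; field.
  by rewrite addmx_sub // scalemx_sub.
- by apply/sub_bridge; exists s3, t3.
Qed.

End MoreCharts.

(** * Normal forms for skew pairs and skew triples *)

Section SpecialCharts.

Variables (k : closedFieldType) (q : nat) (phi : {rmorphism k -> k}).
Hypotheses (phiE : forall x, phi x = x ^+ q) (q_gt1 : (1 < q)%N).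

Local Notation "A ^F" := (map_mx phi A) (at level 2, format "A ^F").

Variable A : 'M[k]_(2 + 2).
Hypothesis Au : A \in unitmx.

Let on := on_surface phi A.

Lemma diag_form (B C P R : 'M[k]_2) g : g^F *m A *m g^T = block_mx 0 B C 0 ->
  (block_mx P 0 0 R *m g)^F *m A *m (block_mx P 0 0 R *m g)^T =
  block_mx 0 (P^F *m B *m R^T) (R^F *m C *m P^T) 0.
Proof.
move=> gE; set E := block_mx P 0 0 R.
have -> : (E *m g)^F *m A *m (E *m g)^T = E^F *m (g^F *m A *m g^T) *m E^T.
  by rewrite map_mxM trmx_mul !mulmxA.
rewrite gE /E map_block_mx tr_block_mx !map_mx0 !trmx0 !mulmx_block.
by rewrite !(mul0mx, mulmx0, addr0, add0r).
Qed.

Lemma unit_diag (P R : 'M[k]_2) g : P \in unitmx -> R \in unitmx -> g \in unitmx ->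
  block_mx P 0 0 R *m g \in unitmx.
Proof.
by move=> Pu Ru gu; rewrite unitmx_mul gu andbT unitmxE det_lblock unitrM -!unitmxE Pu.
Qed.

(** A block-diagonal change by [P] and [R] normalises the first block if R^T is the inverse of P^(q)
    B. The second block then requires P^(q^2) B^(q) = - P C^T, which is an equation of Lang type for
    [P]. *)
Lemma hermitian_chart l m : on l -> on m -> skewb l m ->
  exists g, [/\ g \in unitmx, l = chart g (lineX k), m = chart g (lineY k)
    & g^F *m A *m g^T = block_mx 0 1%:M (- 1%:M) 0].
Proof.
move=> ol om lm.
have [g [B [C [gu -> -> [Bu Cu gE]]]]] := skew_pair_chart phiE q_gt1 Au ol om lm.
have [|P Pu PE] := @lang2 k q phi phiE q_gt1 _ (- (B^F *m invmx C^T)).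
  by rewrite -scaleN1r unitmxZ ?unitrN1 // unitmx_mul map_unitmx Bu unitmx_inv unitmx_tr.
have PCE : P *m C^T = - (P^F^F *m B^F).
  by rewrite -[in LHS]PE mulmxN mulNmx -!mulmxA mulVmx ?unitmx_tr // mulmx1.
have PBu : P^F *m B \in unitmx by rewrite unitmx_mul map_unitmx Pu.
pose R := (invmx (P^F *m B))^T.
have Ru : R \in unitmx by rewrite unitmx_tr unitmx_inv.
have [eX eY] := chart_diag g Pu Ru.
exists (block_mx P 0 0 R *m g); split; rewrite ?unit_diag ?eX ?eY //.
rewrite (diag_form P R gE) trmxK mulmxV //; congr (block_mx _ _ _ _).
apply: trmx_inj.
have -> : (- 1%:M)^T = - 1%:M :> 'M[k]_2 by rewrite linearN /= trmx1.
rewrite !trmx_mul trmxK mulmxA PCE mulNmx -map_trmx trmxK map_invmx map_mxM.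
by rewrite mulmxV // -map_mxM map_unitmx.
Qed.

(** Being skew to both coordinate lines, the third line has invertible halves, which rescale the
    frame so that it becomes x = y. Its lying on the surface then says that the two blocks add up to
    zero. *)
Lemma triad_chart l1 l2 l3 : on l1 -> on l2 -> on l3 ->
  skewb l1 l2 -> skewb l1 l3 -> skewb l2 l3 ->
  exists g B, [/\ g \in unitmx, l1 = chart g (lineX k), l2 = chart g (lineY k),
    l3 = chart g (graph 1%:M)
    & B \in unitmx /\ g^F *m A *m g^T = block_mx 0 B (- B) 0].
Proof.
move=> o1 o2 o3 s12.
have [g [B [C [gu -> -> [Bu Cu gE]]]]] := skew_pair_chart phiE q_gt1 Au o1 o2 s12.
have [d3 _] := o3; have [M] := chart_surj gu d3; rewrite -[M]hsubmxK => Mf l3E.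
rewrite l3E skew_lineX ?skew_lineY //.
set P := lsubmx M in Mf l3E *; set R := rsubmx M in Mf l3E * => Ru Pu.
have [eX eY] := chart_diag g Pu Ru; have g'u := unit_diag Pu Ru gu.
have g'E := diag_form P R gE.
have l3E' : l3 = chart (block_mx P 0 0 R *m g) (graph 1%:M).
  have E : graph 1%:M *m block_mx P 0 0 R = row_mx P R.
    by rewrite /graph mul_row_block !mul1mx addr0 add0r.
  by rewrite l3E /chart mulmxA E.
move: o3; rewrite l3E' => /(on_chart phiE q_gt1 _ g'u (row_free_graph _)).
rewrite g'E form_graph trmx1 map_mx1 mulmx1 mul1mx addrC => /addr0_eq CE.
exists (block_mx P 0 0 R *m g), (P^F *m B *m R^T); split; rewrite ?eX ?eY -?l3E //.
split; last by rewrite g'E -CE opprK.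
by rewrite !unitmx_mul map_unitmx unitmx_tr Pu Bu.
Qed.

End SpecialCharts.

(** * Lines of the surface in a Hermitian frame *)

Section Matrix2.

Variable k : fieldType.

Definition mx2 (a b c d : k) : 'M[k]_2 :=
  \matrix_(i, j) nth 0 (nth [::] [:: [:: a; b]; [:: c; d]] i) j.

Lemma mx2E a b c d : (mx2 a b c d 0 0 = a) * (mx2 a b c d 0 1 = b) *
  (mx2 a b c d 1 0 = c) * (mx2 a b c d 1 1 = d).
Proof. by rewrite !mxE. Qed.

Lemma mx2P (D D' : 'M[k]_2) : D 0 0 = D' 0 0 -> D 0 1 = D' 0 1 ->
  D 1 0 = D' 1 0 -> D 1 1 = D' 1 1 -> D = D'.
Proof.
move=> e00 e01 e10 e11; apply/row_matrixP=> -[[|[|//]] i].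
  by rewrite (_ : Ordinal i = 0); [apply: row2P; rewrite !mxE | apply: val_inj].
by rewrite (_ : Ordinal i = 1); [apply: row2P; rewrite !mxE | apply: val_inj].
Qed.

Lemma row_dotE (u v : 'rV[k]_2) :
  (u *m v^T = 0) <-> u 0 0 * v 0 0 + u 0 1 * v 0 1 = 0.
Proof.
have -> : u 0 0 * v 0 0 + u 0 1 * v 0 1 = (u *m v^T) 0 0.
  rewrite !mxE !big_ord_recl big_ord0 addr0 !mxE.
  by rewrite (_ : lift _ _ = 1) //; apply: val_inj.
by split=> [->|uv]; [rewrite mxE | rewrite [LHS]mx11_scalar uv raddf0].
Qed.

End Matrix2.

Section Counts.

Variables (k : closedFieldType) (q : nat) (phi : {rmorphism k -> k}).
Hypotheses (phiE : forall x, phi x = x ^+ q) (q_gt1 : (1 < q)%N).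
Hypothesis q0 : q%:R = 0 :> k.

Local Notation "A ^F" := (map_mx phi A) (at level 2, format "A ^F").

Lemma card_fixed1 : has_card (fun x : k => phi x = x) q.
Proof.
by apply: has_card_ext (card_fixed q_gt1 q0) => x; rewrite phiE.
Qed.

Lemma card_fixed2 : has_card (fun x : k => phi (phi x) = x) (q * q).
Proof.
have qq0 : (q * q)%:R = 0 :> k by rewrite natrM q0 mul0r.
have qq1 : (1 < q * q)%N by nia.
by apply: has_card_ext (card_fixed qq1 qq0) => x; rewrite !phiE exprM.
Qed.

Let herm (D : 'M[k]_2) : Prop := D^F = D^T.

Lemma hermP (D : 'M[k]_2) : herm D <->
  [/\ phi (D 0 0) = D 0 0, phi (phi (D 0 1)) = D 0 1, phi (D 1 1) = D 1 1
    & D 1 0 = phi (D 0 1)].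
Proof.
rewrite /herm; split=> [/matrixP DF|[e0 e1 e3 e2]].
  have := (DF 0 0, DF 0 1, DF 1 0, DF 1 1).
  by rewrite !mxE => -[[[e0 e1] e2] e3]; split; rewrite // e1.
by apply: mx2P; rewrite !mxE // e2.
Qed.

Let hmx (t : k * (k * k)) : 'M[k]_2 := mx2 t.1 t.2.1 (phi t.2.1) t.2.2.

Let hmx_inj t t' : hmx t = hmx t' -> t = t'.
Proof.
case: t t' => [a [b d]] [a' [b' d']] /matrixP E.
by have := (E 0 0, E 0 1, E 1 1); rewrite !mx2E /= => -[[-> ->] ->].
Qed.

Let coef (t : k * (k * k)) : Prop :=
  phi t.1 = t.1 /\ phi (phi t.2.1) = t.2.1 /\ phi t.2.2 = t.2.2.

Lemma herm_param (D : 'M[k]_2) : herm D <-> exists2 t, coef t & D = hmx t.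
Proof.
split=> [/hermP[e0 e1 e3 e2]|[[a [b d]] [/= e0 [e1 e3]] ->]].
  exists (D 0 0, (D 0 1, D 1 1)); first by split.
  by apply: mx2P; rewrite !mx2E.
by apply/hermP; rewrite !mx2E /=; split.
Qed.

Lemma card_herm : has_card herm (q ^ 4).
Proof.
have -> : (q ^ 4 = q * (q * q * q))%N by rewrite !expnS; ring.
apply: (has_card_image (f := hmx) (P := coef)); last first.
- apply: (has_card_sigma (P := fun a => phi a = a)
      (Q := fun _ t => phi (phi t.1) = t.1 /\ phi t.2 = t.2)) card_fixed1 _.
  move=> _ _; apply: (has_card_sigma (P := fun b => phi (phi b) = b)
      (Q := fun _ d => phi d = d)) card_fixed2 _.
  by move=> _ _; apply: card_fixed1.
- exact: herm_param.
- by move=> t t' _ _; apply: hmx_inj.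
Qed.

(** For entries a, b, b^q, d the condition is ad != b^(q+1). If a is nonzero, b is free in F_(q^2)
    and one value of d in F_q is excluded; if a = 0, b must be nonzero and d is free in F_q. *)
Lemma card_herm_unit :
  has_card (fun D => herm D /\ D \in unitmx) (q * q.-1 * (q ^ 2 + 1)).
Proof.
have hmx_unit t : (hmx t \in unitmx) = (t.1 * t.2.2 != t.2.1 * phi t.2.1).
  by rewrite unitmx2 !mx2E subr_eq0.
pose ok t := coef t /\ t.1 * t.2.2 <> t.2.1 * phi t.2.1.
have cok : has_card ok (q * q.-1 * (q ^ 2 + 1)).
  have -> : (q * q.-1 * (q ^ 2 + 1) = q.-1 * (q * q * q.-1) + 1 * ((q * q).-1 * q))%N.
    by case: (q) q_gt1 => // r _ /=; rewrite !expnS; lia.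
  pose ok1 (t : k * (k * k)) := (phi t.1 = t.1 /\ t.1 <> 0) /\
    (phi (phi t.2.1) = t.2.1 /\ (phi t.2.2 = t.2.2 /\ t.2.2 <> t.2.1 * phi t.2.1 / t.1)).
  pose ok2 (t : k * (k * k)) := t.1 = 0 /\
    ((phi (phi t.2.1) = t.2.1 /\ t.2.1 <> 0) /\ phi t.2.2 = t.2.2).
  apply: (has_card_ext (P := fun t => ok1 t \/ ok2 t)).
    case=> a [b d]; rewrite /ok /coef /ok1 /ok2 /=; split.
      case=> [[[aF a0] [bF [dF dn]]]|[-> [[bF b0] dF]]]; split=> //.
      - by move=> E; apply: dn; rewrite -E mulrC mulrA mulVf ?mul1r //; apply/eqP.
      - by rewrite rmorph0.
      - by rewrite mul0r => /esym/eqP; rewrite mulf_eq0 fmorph_eq0 orbb => /eqP.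
    case=> -[aF [bF dF]] ad; have [a0|/eqP a0] := eqVneq a 0; [right | left].
      split=> //; split=> //; split=> // b0; apply: ad.
      by rewrite a0 b0 !mul0r.
    split=> //; split=> //; split=> // dE; apply: ad.
    by rewrite dE mulrC divfK //; apply/eqP.
  apply: has_card_disjoint.
  - by case=> a [b d] [/= [_ a0] _] [].
  - apply: (has_card_sigma (P := fun a => phi a = a /\ a <> 0)
      (Q := fun a t => phi (phi t.1) = t.1 /\
        (phi t.2 = t.2 /\ t.2 <> t.1 * phi t.1 / a))).
      by apply: has_card_rem card_fixed1; rewrite rmorph0.
    move=> a [aF a0].
    apply: (has_card_sigma (P := fun b => phi (phi b) = b)
      (Q := fun b d => phi d = d /\ d <> b * phi b / a)) card_fixed2 _.
    move=> b bF; apply: has_card_rem card_fixed1.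
    by rewrite !rmorphM fmorphV bF aF [phi b * b]mulrC.
  - apply: (has_card_sigma (P := fun a => a = 0)
      (Q := fun _ t => (phi (phi t.1) = t.1 /\ t.1 <> 0) /\ phi t.2 = t.2)).
      by exists [:: 0]; split=> // x; rewrite inE; split=> /eqP.
    move=> _ _; apply: (has_card_sigma (P := fun b => phi (phi b) = b /\ b <> 0)
      (Q := fun _ d => phi d = d)).
      by apply: has_card_rem card_fixed2; rewrite !rmorph0.
    by move=> _ _; apply: card_fixed1.
apply: (has_card_image (f := hmx)) cok; first by move=> t t' _ _; apply: hmx_inj.
move=> D; split=> [[/herm_param[t ct ->]]|[t [ct /eqP tu] ->]].
  by rewrite hmx_unit => /eqP tu; exists t.
by rewrite hmx_unit; split=> //; apply/herm_param; exists t.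
Qed.

Variable A : 'M[k]_(2 + 2).

Let on := on_surface phi A.

Section HermitianChart.

Variable g : 'M[k]_(2 + 2).
Hypotheses (gu : g \in unitmx) (gE : g^F *m A *m g^T = block_mx 0 1%:M (- 1%:M) 0).

Lemma on_graph D : on (chart g (graph D)) <-> herm D.
Proof.
rewrite /on (on_chart phiE q_gt1 _ gu (row_free_graph D)) gE form_graph.
rewrite mul1mx mulmxN mulmx1 /herm; split=> [/subr0_eq->//|->].
by rewrite subrr.
Qed.

Lemma card_skew_chart : has_card (fun z => on z /\ skewb (chart g (lineY k)) z) (q ^ 4).
Proof.
apply: (has_card_image (f := fun D => chart g (graph D))) card_herm.
  by move=> D D' _ _; apply: graph_inj.
move=> z; split=> [[oz sz]|[D hD ->]].
  have [dz _] := oz; have [D zE] := graph_surj gu dz sz.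
  by exists D; rewrite // -on_graph -zE.
split; first exact/on_graph.
by rewrite skew_lineY ?row_free_graph // unitmx1.
Qed.

Lemma card_skew2_chart : has_card (fun z => on z /\
  skewb (chart g (lineX k)) z /\ skewb (chart g (lineY k)) z) (q * q.-1 * (q ^ 2 + 1)).
Proof.
apply: (has_card_image (f := fun D => chart g (graph D))) card_herm_unit.
  by move=> D D' _ _; apply: graph_inj.
move=> z; split=> [[oz [sXz sz]]|[D [hD Du] ->]].
  have [dz _] := oz; have [D zE] := graph_surj gu dz sz.
  exists D => //; split; first by rewrite -on_graph -zE.
  by move: sXz; rewrite zE skew_lineX ?row_free_graph.
split; first exact/on_graph.
by rewrite skew_lineX ?skew_lineY ?row_free_graph // unitmx1.
Qed.

(* u^(q) v^T = 0 iff v is proportional to dual u. *)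
Let dual (u : 'rV[k]_2) : 'rV[k]_2 := row2 (- phi (u 0 1)) (phi (u 0 0)).

Let dual_neq0 u : u != 0 -> dual u != 0.
Proof.
apply: contraNneq => /rowP ud; have := (ud 0, ud 1); rewrite !mxE /= => -[/eqP].
rewrite oppr_eq0 fmorph_eq0 => /eqP u1 /eqP; rewrite fmorph_eq0 => /eqP u0.
by apply/eqP/row2P; rewrite mxE.
Qed.

(** The points of P^1(F_(q^2)), those fixed by the q^2-Frobenius; [None] is one of them. *)
Let rational (o : option k) : Prop := cross (pt o) (pt o)^F^F = 0.

Let card_rational : has_card rational (q ^ 2 + 1).
Proof.
rewrite addn1 -mulnn; apply: has_card_option.
  apply: has_card_ext card_fixed2 => a; rewrite /rational /cross !mxE /=.
  by rewrite !rmorph1 mul1r mulr1; split=> [->|/subr0_eq//]; rewrite subrr.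
by rewrite /rational /cross !mxE /= !rmorph0 mul0r mulr0 subrr.
Qed.

(** The bridge from u to v lies on the surface iff v is proportional to [dual u] and u to [dual v].
    As [dual (dual u)] is -u^(q^2), this says that v is determined up to scale and that u is
    rational. *)
Lemma transversal2_chart z :
  (on z /\ ~~ skewb (chart g (lineX k)) z /\ ~~ skewb (chart g (lineY k)) z) <->
  exists2 o, rational o & z = chart g (bridge (pt o) (dual (pt o))).
Proof.
have dotE (u v : 'rV[k]_2) : u^F *m v^T = 0 <-> cross (dual u) v = 0.
  rewrite row_dotE /cross /dual !row2E !mxE mulNr -opprD addrC.
  by split=> [->|/eqP]; rewrite ?oppr0 // oppr_eq0 => /eqP.
have crE u : cross (dual (dual u)) u = cross u u^F^F.
  by rewrite /cross /dual !row2E !mxE rmorphN; ring.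
have onE u v : u != 0 -> v != 0 -> on (chart g (bridge u v)) <->
    cross (dual u) v = 0 /\ cross (dual v) u = 0.
  move=> u0 v0; rewrite /on (on_bridge phiE q_gt1 gu gE u0 v0) mulmx1 mulmxN.
  rewrite mulmx1 mulNmx -!dotE; split=> -[-> vu]; split=> //.
    by apply/eqP; rewrite -oppr_eq0 vu.
  by rewrite vu oppr0.
split=> [[oz [sX sY]]|[o ro ->]]; last first.
  have p0 := pt_neq0 o; have d0 := dual_neq0 p0.
  split; last by have [] := bridge_meets gu p0 d0.
  apply/onE => //; split; first by rewrite /cross mulrC subrr.
  by rewrite crE.
have [dz _] := oz; have [o [v [v0 zE]]] := transversal_chart gu dz sX sY.
have p0 := pt_neq0 o; have d0 := dual_neq0 p0.
move: oz; rewrite zE => /onE-/(_ p0 v0)[/(cross0_scale d0 v0)[c c0 vE] vu].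
exists o; last by rewrite vE bridge_scale.
have dualZ w : dual (c *: w) = phi c *: dual w.
  by rewrite /dual; apply: row2P; rewrite !row2E !mxE rmorphM /= ?mulrN.
have crossZ (a : k) (w w' : 'rV[k]_2) : cross (a *: w) w' = a * cross w w'.
  by rewrite /cross !mxE; ring.
move/eqP: vu; rewrite vE dualZ crossZ crE mulf_eq0 fmorph_eq0.
by rewrite (negPf c0) => /eqP.
Qed.

Lemma card_transversal2_chart : has_card (fun z => on z /\
  ~~ skewb (chart g (lineX k)) z /\ ~~ skewb (chart g (lineY k)) z) (q ^ 2 + 1).
Proof.
apply: has_card_image transversal2_chart card_rational.
by move=> o o' _ _; apply: bridge_inj.
Qed.

(** [cross] of two duals is the q-th power of [cross] of the original vectors, so distinct points
    give bridges with distinct ends on both coordinate lines. *)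
Lemma transversal2_skew_chart z z' :
  on z /\ ~~ skewb (chart g (lineX k)) z /\ ~~ skewb (chart g (lineY k)) z ->
  on z' /\ ~~ skewb (chart g (lineX k)) z' /\ ~~ skewb (chart g (lineY k)) z' ->
  z != z' -> skewb z z'.
Proof.
move=> /transversal2_chart[o _ ->] /transversal2_chart[o' _ ->] zz'.
have cr : cross (pt o) (pt o') != 0 by apply: contraNneq zz' => /cross_pt->.
apply: skew_bridge => //; rewrite /cross /dual !row2E.
have -> : - phi (pt o 0 1) * phi (pt o' 0 0) - phi (pt o 0 0) * - phi (pt o' 0 1) =
    phi (cross (pt o) (pt o')) by rewrite /cross rmorphB !rmorphM; ring.
by rewrite fmorph_eq0.
Qed.

End HermitianChart.

End Counts.

(** * Lines of the surface *)

Section SurfaceLines.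

Variables (k : closedFieldType) (q : nat) (phi : {rmorphism k -> k}).
Hypotheses (phiE : forall x, phi x = x ^+ q) (q_gt1 : (1 < q)%N).
Hypothesis q0 : q%:R = 0 :> k.

Local Notation "A ^F" := (map_mx phi A) (at level 2, format "A ^F").

Lemma card_isotropic_points (B : 'M[k]_2) : B \in unitmx ->
  has_card (fun o => (pt o)^F *m B *m (pt o)^T = 0) q.+1.
Proof.
move=> Bu; pose f o := ((pt o)^F *m B *m (pt o)^T) 0 0.
have fE u : (u^F *m B *m u^T) 0 0 = (phi (u 0 0) * B 0 0 + phi (u 0 1) * B 1 0) * u 0 0
    + (phi (u 0 0) * B 0 1 + phi (u 0 1) * B 1 1) * u 0 1 :> k.
  have l1 : lift ord0 ord0 = 1 :> 'I_2 by apply: val_inj.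
  have l0 : ord0 = 0 :> 'I_2 by apply: val_inj.
  rewrite mxE !big_ord_recl big_ord0 addr0 ![(_^F *m _) _ _]mxE.
  by rewrite !big_ord_recl !big_ord0 !addr0 !l1 !l0 !mxE.
have fz o : (pt o)^F *m B *m (pt o)^T = 0 <-> f o = 0.
  by rewrite /f; split=> [->|f0]; [rewrite mxE | rewrite [LHS]mx11_scalar f0 raddf0].
apply: has_card_ext (card_binary_form (f := f) q_gt1 q0 Bu _ _).
- by move=> o; apply: iff_sym.
- move=> a; rewrite /f fE /= !row2E rmorph1 phiE exprSr; ring.
- by rewrite /f fE /= !row2E rmorph0 rmorph1; ring.
Qed.

Variable A : 'M[k]_(2 + 2).
Hypothesis Au : A \in unitmx.

Let on := on_surface phi A.

Implicit Types l m z : {vspace 'rV[k]_(2 + 2)}.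

(** In a Fermat frame, every zero u of u^(q) u^T on P^1 gives a line of the surface joining (u, 0)
    to (0, u), and two different zeros give skew lines. *)
Lemma exists_skew_lines : exists l m, [/\ on l, on m & skewb l m].
Proof.
have [R Ru RE] := fermat_form phiE q_gt1 Au.
have [s [us sP sz]] := card_isotropic_points (unitmx1 _ 2).
have on_b o : (pt o)^F *m 1%:M *m (pt o)^T = 0 ->
    on (chart R (bridge (pt o) (pt o))).
  move=> o0; have p0 := pt_neq0 o.
  apply/(on_chart phiE q_gt1 _ Ru (row_free_bridge p0 p0)).
  have E (u : 'rV[k]_2) : (bridge u u)^F *m 1%:M *m (bridge u u)^T =
      block_mx (u^F *m 1%:M *m u^T) 0 0 (u^F *m 1%:M *m u^T).
    rewrite !mulmx1 /bridge map_block_mx tr_block_mx !map_mx0 !trmx0.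
    by rewrite mulmx_block !(mul0mx, mulmx0, addr0, add0r).
  by rewrite RE; apply: (etrans (E _)); rewrite o0 block_mx0.
case: s us sP sz => [|o [|o' s]] //=.
  by move=> _ _ []; lia.
rewrite inE negb_or => /andP[/andP[oo' _] _] sP _.
exists (chart R (bridge (pt o) (pt o))), (chart R (bridge (pt o') (pt o'))).
have cr : cross (pt o) (pt o') != 0 by apply: contraNneq oo' => /cross_pt->.
split; last exact: skew_bridge.
  by apply/on_b/sP; rewrite inE eqxx.
by apply/on_b/sP; rewrite !inE eqxx orbT.
Qed.

Lemma card_skew l m : on l -> on m -> skewb l m ->
  has_card (fun z => on z /\ skewb l z) (q ^ 4).
Proof.
move=> ol om lm; rewrite skewbC in lm.
have [g [gu _ -> gE]] := hermitian_chart phiE q_gt1 Au om ol lm.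
exact: card_skew_chart.
Qed.

Lemma card_skew2 l m : on l -> on m -> skewb l m ->
  has_card (fun z => on z /\ skewb l z /\ skewb m z) (q * q.-1 * (q ^ 2 + 1)).
Proof.
move=> ol om lm; have [g [gu -> -> gE]] := hermitian_chart phiE q_gt1 Au ol om lm.
exact: card_skew2_chart.
Qed.

Lemma card_transversal2 l m : on l -> on m -> skewb l m ->
  has_card (fun z => on z /\ ~~ skewb l z /\ ~~ skewb m z) (q ^ 2 + 1).
Proof.
move=> ol om lm; have [g [gu -> -> gE]] := hermitian_chart phiE q_gt1 Au ol om lm.
exact: (card_transversal2_chart phiE q_gt1 q0 gu gE).
Qed.

Lemma transversal2_skew l m z z' : on l -> on m -> skewb l m -> on z -> on z' ->
  ~~ skewb l z -> ~~ skewb m z -> ~~ skewb l z' -> ~~ skewb m z' -> z != z' ->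
  skewb z z'.
Proof.
move=> ol om lm oz oz'.
have [g [gu -> -> gE]] := hermitian_chart phiE q_gt1 Au ol om lm.
move=> lz mz lz' mz'; exact: (transversal2_skew_chart phiE q_gt1 gu gE).
Qed.

Section TriadChart.

Variables (g : 'M[k]_(2 + 2)) (B : 'M[k]_2).
Hypotheses (gu : g \in unitmx) (gE : g^F *m A *m g^T = block_mx 0 B (- B) 0).

(** Meeting the line x = y forces both ends of a bridge to be the same point u of P^1; the blocks
    [B] and [- B] then impose the same condition on u. *)
Lemma transversal3_chart z :
  [/\ on z, ~~ skewb (chart g (lineX k)) z, ~~ skewb (chart g (lineY k)) z
    & ~~ skewb (chart g (graph 1%:M)) z] <->
  exists2 o, (pt o)^F *m B *m (pt o)^T = 0 & z = chart g (bridge (pt o) (pt o)).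
Proof.
split=> [[oz zX zY]|[o o0 ->]]; last first.
  have p0 := pt_neq0 o; have [mX mY] := bridge_meets gu p0 p0; split=> //.
    by apply/(on_bridge phiE q_gt1 gu gE p0 p0); rewrite mulmxN mulNmx o0 oppr0.
  by apply/(bridge_diag gu) => //; exists 1; rewrite ?oner_neq0 ?scale1r.
have [dz _] := oz; have [o [v [v0 zE]]] := transversal_chart gu dz zX zY.
have p0 := pt_neq0 o; rewrite zE => /(bridge_diag gu p0 v0)[c c0 vE].
have zE' : z = chart g (bridge (pt o) (pt o)) by rewrite zE vE bridge_scale.
exists o; last by rewrite -zE' zE.
by move: oz; rewrite zE' => /(on_bridge phiE q_gt1 gu gE p0 p0)[].
Qed.

End TriadChart.

Lemma card_transversal3 l1 l2 l3 : on l1 -> on l2 -> on l3 ->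
  skewb l1 l2 -> skewb l1 l3 -> skewb l2 l3 ->
  has_card (fun z => [/\ on z, ~~ skewb l1 z, ~~ skewb l2 z & ~~ skewb l3 z]) q.+1.
Proof.
move=> o1 o2 o3 s12 s13 s23.
have [g [B [gu -> -> -> [Bu gE]]]] := triad_chart phiE q_gt1 Au o1 o2 o3 s12 s13 s23.
apply: has_card_image (transversal3_chart gu gE) (card_isotropic_points Bu).
by move=> o o' _ _; apply: bridge_inj.
Qed.

Lemma regulus_meets l1 l2 l3 a b b1 b2 b3 :
  let trans z := [/\ on z, ~~ skewb l1 z, ~~ skewb l2 z & ~~ skewb l3 z] in
  on l1 -> on l2 -> on l3 -> skewb l1 l2 -> skewb l1 l3 -> skewb l2 l3 ->
  on a -> trans b -> trans b1 -> trans b2 -> trans b3 ->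
  b1 != b2 -> b2 != b3 -> b3 != b1 ->
  ~~ skewb a b1 -> ~~ skewb a b2 -> ~~ skewb a b3 -> ~~ skewb a b.
Proof.
move=> /= o1 o2 o3 s12 s13 s23 [da _].
have [g [B [gu -> -> -> [Bu gE]]]] := triad_chart phiE q_gt1 Au o1 o2 o3 s12 s13 s23.
move=> /(transversal3_chart gu gE)[o _ ->] /(transversal3_chart gu gE)[p1 _ ->].
move=> /(transversal3_chart gu gE)[p2 _ ->] /(transversal3_chart gu gE)[p3 _ ->].
have ne (p p' : option k) :
    chart g (bridge (pt p) (pt p)) != chart g (bridge (pt p') (pt p')) -> p != p'.
  by apply: contra => /eqP->.
by move=> /ne n12 /ne n23 /ne n31; apply: regulus_chart.
Qed.

End SurfaceLines.

(** * Frobenius forms as matrices *)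

Section FrobeniusForm.

Variables (k : closedFieldType) (n q : nat) (phi : {rmorphism k -> k}).
Hypotheses (phiE : forall x, phi x = x ^+ q) (q_gt1 : (1 < q)%N).
Hypothesis q0 : q%:R = 0 :> k.

Local Notation "A ^F" := (map_mx phi A) (at level 2, format "A ^F").

Lemma linear_form (L : {mpoly k[n]}) : L \is 1.-homog ->
  L = \sum_(j < n) L@_U_(j) *: 'X_j.
Proof.
move=> Lh; apply/mpolyP=> m; rewrite raddf_sum /=.
have [/mdeg1P[i /eqP->]|m1] := boolP (mdeg m == 1%N).
  rewrite (bigD1 i) //= mcoeffZ mcoeffXU eqxx mulr1 big1 ?addr0 // => j ji.
  by rewrite mcoeffZ mcoeffXU (negPf ji) mulr0.
rewrite (dhomog_nemf_coeff Lh m1) big1 // => j _; rewrite mcoeffZ mcoeffX.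
have [E|_] := eqVneq U_(j)%MM m; last by rewrite mulr0.
by rewrite -E mdeg1 eqxx in m1.
Qed.

(** The rows of [A] are the coefficients of the L_i. The factors x_i^q have zero derivative because
    q = 0 in [k], so the gradient is linear in v^(q). *)
Lemma frobenius_formP (F : {mpoly k[n]}) : frobenius_form q F ->
  exists A : 'M[k]_n,
    (forall v : 'rV_n, F.@[v 0] = (v^F *m A *m v^T) 0 0) /\
    (forall (v : 'rV_n) j, (F^`M(j)).@[v 0] = (v^F *m A) 0 j).
Proof.
case=> _ [L [Lh FE]]; pose A := \matrix_(i, j) (L i)@_U_(j); exists A.
have LE i : L i = \sum_(j < n) A i j *: 'X_j.
  by rewrite {1}(linear_form (Lh i)); apply: eq_bigr => j _; rewrite mxE.
split=> v => [|j].
  rewrite FE raddf_sum -mulmxA mxE; apply: eq_bigr => i _ /=.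
  rewrite mevalM rmorphXn /= mevalXU LE raddf_sum !mxE phiE; congr (_ * _).
  by apply: eq_bigr => j _ /=; rewrite mevalZ mevalXU !mxE.
have dsum (G : 'I_n -> {mpoly k[n]}) : (\sum_i G i)^`M(j) = \sum_i (G i)^`M(j).
  exact: (raddf_sum (mderiv j)).
have dL i : (L i)^`M(j) = (A i j)%:MP.
  have mE : (U_(j) - U_(j) = 0 :> 'X_{1.. n})%MM by rewrite -{1}[U_(j)%MM]add0m addmK.
  rewrite LE dsum (bigD1 j) //= mderivZ mderivX mnm1E eqxx scale1r mE.
  rewrite mpolyX0 alg_mpolyC big1 ?addr0 // => l lj.
  by rewrite mderivZ mderivX mnm1E (negPf lj) scale0r scaler0.
rewrite FE dsum raddf_sum mxE; apply: eq_bigr => i _ /=.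
rewrite mderivM dL mpolyXn mderivX mulmnE natrM q0 mulr0 scale0r mul0r add0r.
by rewrite -mpolyXn mevalM rmorphXn /= mevalXU mevalC [v^F 0 i]mxE phiE.
Qed.

(** A row in the left kernel of [A] is v^(q) for some v, as [k] has q-th roots; the form and its
    gradient both vanish at v. *)
Lemma smooth_unitmx (F : {mpoly k[n]}) (A : 'M[k]_n) :
    (forall v : 'rV_n, F.@[v 0] = (v^F *m A *m v^T) 0 0) ->
    (forall (v : 'rV_n) j, (F^`M(j)).@[v 0] = (v^F *m A) 0 j) ->
  smooth_hypersurface F -> A \in unitmx.
Proof.
move=> FA dFA sF; rewrite -row_free_unit -kermx_eq0; apply/rowV0P=> w.
move/sub_kermxP=> wA.
have [f fE] := fin_all_exists (fun j => artin_schreier_root phiE q_gt1 0 (w 0 j)).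
pose v := \row_j f j.
have vw : v^F = w by apply/rowP=> j; rewrite !mxE fE mul0r add0r.
have [v0|v0] := eqVneq v 0; first by rewrite -vw v0 map_mx0.
have [|j] := sF v v0; first by rewrite FA vw wA mul0mx mxE.
by rewrite dFA vw wA mxE eqxx.
Qed.

Lemma smooth_neq0 (F : {mpoly k[n]}) : (0 < n)%N ->
  smooth_hypersurface F -> F != 0.
Proof.
case: n F => // m F _ sF; apply/eqP=> F0.
have [||j] := sF (const_mx 1).
- by apply/eqP=> /rowP/(_ 0); rewrite !mxE; apply/eqP; apply: oner_neq0.
- by rewrite F0 meval0.
by rewrite F0 mderiv0 meval0 eqxx.
Qed.

End FrobeniusForm.

Lemma frobenius_power (k : fieldType) (p e : nat) : p \in [pchar k] ->
  exists phi : {rmorphism k -> k}, forall x, phi x = x ^+ (p ^ e).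
Proof.
move=> hp; elim: e => [|e [phi phiE]]; first by exists idfun => x; rewrite expr1.
exists (phi \o pFrobenius_aut hp) => x /=.
by rewrite phiE pFrobenius_autE -exprM expnS.
Qed.

(** * Quadric configurations *)

Section FsetOfSet.

Variables (T : choiceType) (L : {fset T}).

(** Passes from subsets of the finite type of lines, where grids live, to finite sets of subspaces,
    where configurations live. *)
Definition fset_of (X : {set L}) : {fset T} := [fset x in map val (enum X)]%fset.

Lemma mem_fset_of (X : {set L}) (x : L) : (val x \in fset_of X) = (x \in X).
Proof. by rewrite inE /= mem_map ?mem_enum //; apply: val_inj. Qed.

Lemma fset_ofP (X : {set L}) y :
  reflect (exists2 x : L, x \in X & y = val x) (y \in fset_of X).
Proof.
rewrite inE /=; apply: (iffP mapP) => -[x xX ->]; exists x => //.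
  by rewrite mem_enum in xX.
by rewrite mem_enum.
Qed.

Lemma card_fset_of X : #|` fset_of X| = #|X|.
Proof.
rewrite card_fseq undup_id ?size_map ?cardE //.
by rewrite map_inj_uniq ?enum_uniq //; apply: val_inj.
Qed.

Lemma fset_of_inj : injective fset_of.
Proof. by move=> X Y XY; apply/setP=> x; rewrite -!mem_fset_of XY. Qed.

Lemma fset_of_setU X Y : fset_of (X :|: Y) = (fset_of X `|` fset_of Y)%fset.
Proof.
apply/fsetP=> y; rewrite in_fsetU; apply/fset_ofP/orP.
  by case=> x /setUP[] xX ->; rewrite !mem_fset_of xX; [left | right].
by case=> /fset_ofP[x xX ->]; exists x; rewrite ?inE ?xX ?orbT.
Qed.

Lemma fset_of_surj (C : {fset T}) : (forall x, x \in C -> x \in L) ->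
  exists X, C = fset_of X.
Proof.
move=> CL; exists [set x : L | val x \in C]; apply/fsetP=> y.
apply/idP/fset_ofP => [yC|[x]]; last by rewrite inE => ? ->.
by exists [` CL y yC]%fset; rewrite ?inE.
Qed.

End FsetOfSet.

Section Configurations.

Variables (k : closedFieldType) (q : nat) (phi : {rmorphism k -> k}).
Hypotheses (phiE : forall x, phi x = x ^+ q) (q_gt1 : (1 < q)%N).
Hypothesis q0 : q%:R = 0 :> k.
Variable A : 'M[k]_(2 + 2).
Hypothesis Au : A \in unitmx.

Let on := on_surface phi A.

(** Given a skew pair, every line of the surface is skew to one of the two or meets both, and each
    of these families is finite. *)
Lemma card_lines : exists L : {fset {vspace 'rV[k]_(2 + 2)}},
  forall z, z \in L <-> on z.
Proof.
have [l [m [ol om lm]]] := exists_skew_lines phiE q_gt1 q0 Au.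
have ml : skewb m l by rewrite skewbC.
have [s1 [_ s1P _]] := card_skew phiE q_gt1 q0 Au ol om lm.
have [s2 [_ s2P _]] := card_skew phiE q_gt1 q0 Au om ol ml.
have [s3 [_ s3P _]] := card_transversal2 phiE q_gt1 q0 Au ol om lm.
exists (seq_fset tt (s1 ++ s2 ++ s3)) => z; rewrite seq_fsetE !mem_cat; split.
  by case/or3P=> [/s1P|/s2P|/s3P] [].
move=> oz; case lz: (skewb l z); first by apply/orP; left; apply/s1P.
case mz: (skewb m z); first by apply/or3P; apply: Or32; apply/s2P.
by apply/or3P; apply: Or33; apply/s3P; rewrite lz mz.
Qed.

Lemma skewb_irr z : on z -> skewb z z = false.
Proof.
move=> [dz _]; apply/negP; rewrite /skewb capvv => /eqP z0.
by rewrite z0 dimv0 in dz.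
Qed.

Lemma card_configurations (L : {fset {vspace 'rV[k]_(2 + 2)}}) :
    (forall z, z \in L <-> on z) ->
  let sk (x y : L) := skewb (val x) (val y) in
  (2 * #|[set AB.1 :|: AB.2 | AB in [set AB | grid sk q AB]]| =
   (q ^ 3 + 1) * (q ^ 2 + 1) * q ^ 4)%N.
Proof.
move=> LP sk; have onL (x : L) : on (val x) by apply/LP/valP.
have [l [m [/LP lL /LP mL lm]]] := exists_skew_lines phiE q_gt1 q0 Au.
apply: card_grid_unions => //.
- by move=> x y; apply: skewbC.
- by move=> x; apply: skewb_irr.
- by exists [` lL]%fset, [` mL]%fset.
- move=> x y sxy; have c := card_skew phiE q_gt1 q0 Au (onL x) (onL y) sxy.
  apply: card_sub_has_card c.
    by move=> z [/LP].
  by move=> z; split=> [xz|[]//]; split; first exact: onL.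
- move=> x y sxy; have c := card_skew2 phiE q_gt1 q0 Au (onL x) (onL y) sxy.
  apply: card_sub_has_card c.
    by move=> z [/LP].
  by move=> z; split=> [/andP[]|[_ [xz yz]]]; [split; first exact: onL | apply/andP].
- move=> x y sxy; have c := card_transversal2 phiE q_gt1 q0 Au (onL x) (onL y) sxy.
  apply: card_sub_has_card c.
    by move=> z [/LP].
  by move=> z; split=> [/andP[]|[_ [xz yz]]]; [split; first exact: onL | apply/andP].
- move=> x y z z' sxy xz yz xz' yz' zz'.
  apply: (transversal2_skew phiE q_gt1 Au (onL x) (onL y) sxy (onL z) (onL z')
    xz yz xz' yz').
  by rewrite (inj_eq val_inj).
- move=> x y z sxy sxz syz.
  have c := card_transversal3 phiE q_gt1 q0 Au (onL x) (onL y) (onL z) sxy sxz syz.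
  apply: card_sub_has_card c.
    by move=> w [/LP].
  by move=> w; split=> [/and3P[]|[_ xw yw zw]]; [split; first exact: onL | apply/and3P].
- move=> x y z a b b1 b2 b3 sxy sxz syz.
  have tr w : w \in trans sk x y z -> [/\ on (val w), ~~ skewb (val x) (val w),
      ~~ skewb (val y) (val w) & ~~ skewb (val z) (val w)].
    by rewrite inE => /and3P[]; split; first exact: onL.
  move=> /tr tb /tr tb1 /tr tb2 /tr tb3.
  exact: (regulus_meets phiE q_gt1 Au (onL x) (onL y) (onL z) sxy sxz syz (onL a)
    tb tb1 tb2 tb3).
Qed.

End Configurations.

Lemma on_surfaceP (k : closedFieldType) (phi : {rmorphism k -> k})
    (F : {mpoly k[4]}) (A : 'M[k]_4) (l : {vspace 'rV[k]_4}) :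
  (forall v : 'rV_4, F.@[v 0] = (map_mx phi v *m A *m v^T) 0 0) ->
  line_on F l <-> on_surface phi A l.
Proof.
move=> FA; split=> -[dl Fl]; split=> // v vl.
  by rewrite [LHS]mx11_scalar -FA Fl // raddf0.
by rewrite FA Fl // mxE.
Qed.

Theorem corollary5p1p3 (k : closedFieldType) (p e q : nat)
    (hp : p \in [pchar k]) (he : (1 <= e)%N) (hq : q = (p ^ e)%N)
    (F : {mpoly k[4]}) (hF : frobenius_form q F)
    (hX : smooth_hypersurface F) :
  exists S : {fset {fset {vspace 'rV[k]_4}}},
    (forall C : {fset {vspace 'rV[k]_4}},
       C \in S <-> quadric_configuration F C) /\
    (2 * #|` S|)%N = ((q ^ 3 + 1) * (q ^ 2 + 1) * q ^ 4)%N.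
Proof.
have [phi phiE'] := frobenius_power e hp.
have phiE x : phi x = x ^+ q by rewrite hq.
have p1 := prime_gt1 (pcharf_prime hp).
have q_gt1 : (1 < q)%N by rewrite hq -(exp1n e) ltn_exp2r.
have q0 : q%:R = 0 :> k.
  by rewrite hq -(prednK he) expnS natrM (pcharf0 hp) mul0r.
have [A [FA dFA]] := frobenius_formP phiE q0 hF.
have Au := smooth_unitmx phiE q_gt1 FA dFA hX.
(* A nonzero homogeneous polynomial has only one degree. *)
have d : (msize F).-1 = q.+1.
  have F0 := smooth_neq0 (isT : (0 < 4)%N) hX; have [Fh _] := hF.
  exact: dhomog_uniq F0 (dhomog_msize Fh) Fh.
have [L LP] := card_lines phiE q_gt1 q0 Au.
pose sk (x y : L) := skewb (val x) (val y).
pose U := [set AB.1 :|: AB.2 | AB in [set AB | grid sk q AB]].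
have cU : (2 * #|U| = (q ^ 3 + 1) * (q ^ 2 + 1) * q ^ 4)%N.
  exact: (card_configurations phiE q_gt1 q0 Au LP).
have LF z : z \in L <-> line_on F z by rewrite LP (on_surfaceP _ FA).
have skP (x y : L) : Defs.skew (val x) (val y) <-> sk x y.
  by rewrite /Defs.skew /Defs.meet /sk /skewb; split=> [/negP|->]; rewrite ?negbK.
exists (seq_fset tt (map (@fset_of _ L) (enum U))); split; last first.
  rewrite size_seq_fset undup_id ?size_map -?cardE //.
  by rewrite map_inj_uniq ?enum_uniq //; apply: fset_of_inj.
move=> C; rewrite seq_fsetE; split.
  case/mapP=> X; rewrite mem_enum => /imsetP[[A0 B0]]; rewrite inE => gAB -> -> /=.
  have [cA cB skA skB mAB] := gridP _ _ _ _ gAB.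
  split; first by move=> l /fset_ofP[x _ ->]; apply/LF/valP.
  split.
    rewrite card_fset_of d; apply: card_grid_union gAB => //.
  exists (fset_of A0), (fset_of B0); rewrite fset_of_setU !card_fset_of d.
  split=> //; split=> //; split=> //; split; [|split].
  - move=> l m /fset_ofP[x xA ->] /fset_ofP[y yA ->] xy; apply/skP/skA => //.
    by apply/eqP=> E; rewrite E in xy.
  - move=> l m /fset_ofP[x xB ->] /fset_ofP[y yB ->] xy; apply/skP/skB => //.
    by apply/eqP=> E; rewrite E in xy.
  - by move=> l m /fset_ofP[x xA ->] /fset_ofP[y yB ->]; apply: mAB.
case=> CL [_ [A1 [B1 [CE [cA [cB [skA [skB mAB]]]]]]]].
(* Both halves of a configuration consist of lines of the surface, so they come from subsets of [L],
   and these form a grid. *)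
have [A0 AE] : exists A0, A1 = @fset_of _ L A0.
  by apply: fset_of_surj => l lA; apply/LF/CL; rewrite CE in_fsetU lA.
have [B0 BE] : exists B0, B1 = @fset_of _ L B0.
  by apply: fset_of_surj => l lB; apply/LF/CL; rewrite CE in_fsetU lB orbT.
apply/mapP; exists (A0 :|: B0); last by rewrite fset_of_setU CE AE BE.
rewrite mem_enum; apply/imsetP; exists (A0, B0); rewrite // inE.
rewrite AE BE !card_fset_of d in cA cB skA skB mAB.
apply/gridP; split=> // x y xA yA.
- by move=> xy; apply/skP/skA; rewrite ?mem_fset_of // => /val_inj/eqP; apply/negP.
- by move=> xy; apply/skP/skB; rewrite ?mem_fset_of // => /val_inj/eqP; apply/negP.
- by apply: mAB; rewrite mem_fset_of.
Qed.
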